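(* Let $A=\{0,1,2,6,9\}$ and let $\mathcal S^\infty\subset\mathbb R^2$ be the planar product Cantor set in base $25$ with digit sets $A_1=A_2=A$, i.e. $$\mathcal S^\infty=\Big\{\sum_{k=1}^\infty 25^{-k}\alpha_k:\ \alpha_k\in A\times A\ \text{for all }k\geq 1\Big\}.$$ Then for every $u>0$ there exist $N_u\in\mathbb N$ and a constant $C_u>0$ such that $$\operatorname{Fav}\big(\mathcal N_{25^{-N}}(\mathcal S^\infty)\big)\leq C_u N^{-1/3+u}\qquad\text{for all integers } N\geq N_u.$$
   Context: For $\theta\in\mathbb S^{1}$ and $x\in\mathbb R^2$ let $\pi_\theta(x)=x\cdot\theta$. Let $\sigma^{1}$ be the normalized arclength measure on $\mathbb S^1$ and $\mathcal H^1$ the one-dimensional Hausdorff (Lebesgue) measure. The Favard length of $E\subset\mathbb R^2$ is $\operatorname{Fav}(E)=\int_{\mathbb S^{1}}\mathcal H^1(\pi_\theta(E))\,d\sigma^{1}(\theta)$. For $\delta>0$, $\mathcal N_\delta(E)=\{x\in\mathbb R^2:\operatorname{dist}(x,E)<\delta\}$. *)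

(* Defs.v *)
From HB Require Import structures.
From mathcomp Require Import all_boot all_order all_algebra.
From mathcomp Require Import all_classical all_reals all_analysis.
From mathcomp Require Import measurable_realfun.

Set Implicit Arguments.
Unset Strict Implicit.
Unset Printing Implicit Defensive.

Import Order.TTheory GRing.Theory Num.Theory numFieldNormedType.Exports.

Local Open Scope classical_set_scope.
Local Open Scope ring_scope.

(* The plane is [R * R]; the library norm on this type is the sup norm, hence
   the explicit Euclidean structure. *)
Definition dotp {R : realType} (x y : R * R) : R := x.1 * y.1 + x.2 * y.2.

Definition enorm {R : realType} (x : R * R) : R := Num.sqrt (dotp x x).

Definition unit_circle {R : realType} : set (R * R) := [set x | enorm x = 1].

Definition proj {R : realType} (theta x : R * R) : R := dotp x theta.

(* Extended-real-valued, so that the distance to the empty set is [+oo]. *)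
Definition edist_set {R : realType} (x : R * R) (E : set (R * R)) : \bar R :=
  ereal_inf [set (enorm (x - y))%:E | y in E].

Definition nbhd {R : realType} (delta : R) (E : set (R * R)) : set (R * R) :=
  [set x | (edist_set x E < delta%:E)%E].

Definition circle_param {R : realType} (t : measurableTypeR R) : R * R := (cos t, sin t).

Lemma measurable_circle_param (R : realType) :
  measurable_fun [set: measurableTypeR R] (@circle_param R).
Proof.
apply: measurable_fun_pair; apply: continuous_measurable_fun.
  exact: continuous_cos.
exact: continuous_sin.
Qed.

HB.instance Definition _ (R : realType) :=
  isMeasurableFun.Build _ _ _ _ (@circle_param R) (@measurable_circle_param R).

Lemma two_pi_gt0 (R : realType) : 0 < 2 * pi :> R.
Proof. by rewrite mulr_gt0 // pi_gt0. Qed.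

(* Normalized arclength on the unit circle: [circle_param] has unit speed on
   [0, 2 * pi], so this is the law of [circle_param T] for [T] uniform there. *)
Definition sigma1 (R : realType) : probability (R * R)%type R :=
  distribution (uniform_prob (two_pi_gt0 R)) (@circle_param R).

(* One-dimensional Hausdorff measure on the line is Lebesgue measure. *)
Definition favard {R : realType} (E : set (R * R)) : \bar R :=
  (\int[sigma1 R]_(theta in unit_circle) lebesgue_measure (proj theta @` E))%E.

(* [alpha] is indexed from 1: its value at 0 plays no role. *)
Definition product_cantor {R : realType} (L : nat) (A1 A2 : set R) :
    set (R * R) :=
  [set x | exists alpha : nat -> R * R,
    (forall k, (1 <= k)%N -> (A1 `*` A2) (alpha k)) /\
    (\sum_(1 <= k < n) L%:R ^- k *: alpha k) @[n --> \oo] --> x].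

Definition digits {R : realType} : set R := [set` [:: 0; 1; 2; 6; 9]].

(* Main.v *)
(* Fix a direction [theta]. The projected 25-adic cylinders of level [n] are
   intervals of length about [25^-n] around the points [point w], [w] a word of
   length [n]; call [w] heavy if at least [K] of these points lie within [25^-n]
   of [point w].

   (1) A proportion at least [1 / (150 K)] of the words of length
   [N ~ K^2 log K] have a heavy prefix. Otherwise, splitting words at their
   first heavy prefix and using self-similarity, the number of close pairs of
   words of length [N] is at most [2 K 25^N], which by duality bounds
   [sum_(k < 25^N) |mu_hat k|^2] by [O(K)] for the discrete projected measure
   [mu] of level [N]. On the other hand, since [|sum_(a in A) e^(i a x)| >= 1]
   for every [x], with equality at [pi], the factors of [mu_hat] are at least
   [1/25]; comparing with the trivial lower bound for
   [sum_(k < 25^(a + m)) |mu_hat_a k|^2], where [25^m ~ K], each window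
   [25^a <= k < 25^(a + m)] of frequencies contributes at least [c 25^-m], and
   there are more than [C K 25^m] disjoint windows.

   (2) Iterating (1) over [K log K] blocks of length [N], all but a proportion
   [1/K] of the words have a heavy prefix, and by Vitali's lemma the cylinders
   of words with a heavy prefix project to a set of measure [O(1/K)].

   Hence the projection of the [25^-M]-neighbourhood has measure [O(1/K)] for
   [M ~ K^3 (log K)^2], uniformly in [theta]. *)
Require Import Defs.
From mathcomp Require Import all_boot all_order all_algebra.
From mathcomp Require Import all_classical all_reals all_analysis.
From mathcomp Require Import measurable_realfun.
From mathcomp Require Import ring lra zify.

Set Implicit Arguments.
Unset Strict Implicit.
Unset Printing Implicit Defensive.

Import Order.TTheory GRing.Theory Num.Theory numFieldNormedType.Exports.
Local Open Scope classical_set_scope.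
Local Open Scope ring_scope.

(** * Trigonometric estimates *)

Section Trigonometry.
Variable R : realType.
Implicit Types x y : R.

(** The squared modulus of an exponential sum, kept in real form. *)
Definition cos_sq_sum (T : Type) (s : seq T) (f : T -> R) (x : R) : R :=
  (\sum_(i <- s) cos (f i * x)) ^+ 2 + (\sum_(i <- s) sin (f i * x)) ^+ 2.

Lemma cos_sq_sumE (T : Type) (s : seq T) (f : T -> R) x :
  cos_sq_sum s f x = \sum_(i <- s) \sum_(j <- s) cos ((f i - f j) * x).
Proof.
rewrite /cos_sq_sum !expr2 !big_distrl /= -big_split /=.
apply: eq_bigr => i _; rewrite !big_distrr /= -big_split /=.
by apply: eq_bigr => j _; rewrite mulrBl cosB.
Qed.

Lemma cos_sq_sum_ge0 (T : Type) (s : seq T) (f : T -> R) x :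
  0 <= cos_sq_sum s f x.
Proof. by rewrite addr_ge0 ?sqr_ge0. Qed.

(** In terms of [c = cos x] the sum minus 1 is [(1 + c) * q], with [q] a polynomial nonnegative on
    [-1, 1]; the factor [1 + c] reflects equality at [pi]. *)
Lemma digits_cos_sq_sum_ge1 x :
  1 <= cos_sq_sum [:: 0; 1; 2; 6; 9] id x.
Proof.
set c := cos x; set s := sin x.
have hcs : s ^+ 2 = 1 - c ^+ 2 by rewrite /c /s sin2cos2.
have c1 : -1 <= c by apply: cos_geN1.
have c2 : c <= 1 by apply: cos_le1.
have E2 : (cos (2 * x) = 2 * c ^+ 2 - 1) * (sin (2 * x) = 2 * s * c).
  by rewrite mulr_natl !cos_mulr2n !sin_mulr2n; split; rewrite -/c -/s; ring.
have E3 : (cos (3 * x) = 4 * c ^+ 3 - 3 * c) *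
    (sin (3 * x) = s * (4 * c ^+ 2 - 1)).
  have -> : 3 * x = 2 * x + x by ring.
  by rewrite cosD sinD !E2 -/c -/s; split; ring: hcs.
have E6 : (cos (6 * x) = 2 * cos (3 * x) ^+ 2 - 1) *
    (sin (6 * x) = 2 * sin (3 * x) * cos (3 * x)).
  have -> : 6 * x = (3 * x) *+ 2 by ring.
  by rewrite cos_mulr2n sin_mulr2n; split; ring.
have E9 : (cos (9 * x) = cos (6 * x) * cos (3 * x) - sin (6 * x) * sin (3 * x))
    * (sin (9 * x) = sin (6 * x) * cos (3 * x) + cos (6 * x) * sin (3 * x)).
  have -> : 9 * x = 6 * x + 3 * x by ring.
  by rewrite cosD sinD.
rewrite /cos_sq_sum !big_cons !big_nil mul0r cos0 sin0 !mul1r.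
rewrite !E9 !E6 !E3 !E2 -/c -/s.
set lhs := (X in 1 <= X).
pose u := 16 * c ^+ 4 - 4 * c ^+ 3 - 563 / 45 * c ^+ 2 + 88 / 45 * c + 14 / 15.
pose v := 3 / 5 * c ^+ 3 - 101 / 45 * c ^+ 2 + 8 / 45 * c + 1.
pose q := 4 + 8 * c - 48 * c ^+ 2 - 112 * c ^+ 3 + 352 * c ^+ 4 +
  320 * c ^+ 5 - 768 * c ^+ 6 - 256 * c ^+ 7 + 512 * c ^+ 8.
have -> : lhs = 1 + (1 + c) * q by rewrite /lhs /q; ring: hcs.
(* [u] and [v] are rational roundings of a factorization
   [q - 1/4 = 2 (u ^ 2 + v ^ 2)]; the error is absorbed by [1/4]. *)
suff : 0 <= q by nra.
(* In [q - 2 u ^ 2 - 2 v ^ 2] the degrees 7 and 8 cancel and the other nonconstant coefficients are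
   small, so bounding each power of [c] by 1 suffices. *)
have hk k : -1 <= c ^+ k <= 1.
  by rewrite -ler_norml normrX exprn_ile1 // ler_norml c1 c2.
have := (hk 2, hk 3, hk 4, hk 5, hk 6).
move=> [[[[/andP[? ?] /andP[? ?]] /andP[? ?]] /andP[? ?]] /andP[? ?]].
have : 0 <= q - 2 * u ^+ 2 - 2 * v ^+ 2 by rewrite /q /u /v; lra.
by move: (sqr_ge0 u) (sqr_ge0 v); lra.
Qed.

(** Integrates inequalities: the three Taylor bounds below follow from one another, starting at
    [cos <= 1]. *)
Lemma ge0_of_derive (f g : R -> R) :
  (forall y, is_derive y 1 f (g y)) -> f 0 = 0 ->
  (forall y, 0 <= y -> 0 <= g y) -> forall x, 0 <= x -> 0 <= f x.
Proof.
move=> fg f0 g0 x x0; rewrite -f0.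
have df y : derivable f y 1 by case: (fg y).
apply: (@ger0_derive1_le_cc _ _ 0 x) => //; rewrite ?in_itv /= ?lexx ?x0 //.
  by move=> y; rewrite in_itv /= => /andP[/ltW y0 _];
    rewrite derive1E (@derive_val _ _ _ _ _ _ _ (fg y)) g0.
apply: continuous_subspaceT => y.
by apply/differentiable_continuous/derivable1_diffP/df.
Qed.

Lemma sin_le x : 0 <= x -> sin x <= x.
Proof.
move=> x0; rewrite -subr_ge0.
apply: (@ge0_of_derive (fun y => y - sin y) (fun y => 1 - cos y)) x x0.
- by rewrite sin0 subr0.
- by move=> y _; rewrite subr_ge0 cos_le1.
Qed.

Lemma cos_ge x : 1 - x ^+ 2 / 2 <= cos x.
Proof.
wlog x0 : x / 0 <= x => [hw|].
  by case: (leP 0 x) => [/hw //|/ltW x0]; rewrite -sqrrN -cosN hw // oppr_ge0.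
rewrite -subr_ge0.
apply: (@ge0_of_derive (fun y => cos y - (1 - y ^+ 2 / 2)) (fun y =>
  y - sin y)) x x0.
- move=> y; apply: is_derive_eq; rewrite /GRing.scale /=; lra.
- by rewrite cos0 expr0n /= mul0r subr0 subrr.
- by move=> y y0; rewrite subr_ge0 sin_le.
Qed.

Lemma sin_ge x : 0 <= x -> x - x ^+ 3 / 6 <= sin x.
Proof.
move=> x0; rewrite -subr_ge0.
apply: (@ge0_of_derive (fun y => sin y - (y - y ^+ 3 / 6))
  (fun y => cos y - (1 - y ^+ 2 / 2))) x x0.
- move=> y; apply: is_derive_eq; rewrite /GRing.scale /=; lra.
- by rewrite sin0 expr0n /= mul0r !subr0.
- by move=> y y0; rewrite subr_ge0 cos_ge.
Qed.

Lemma one_sub_cos_ge x : `|x| <= 1 -> x ^+ 2 / 3 <= 1 - cos x.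
Proof.
wlog x0 : x / 0 <= x => [hw|].
  by case: (leP 0 x) => [/hw //|/ltW x0]; rewrite -sqrrN -cosN -normrN;
    apply: hw; rewrite oppr_ge0.
rewrite ger0_norm // => x1.
have -> : cos x = 1 - 2 * sin (x / 2) ^+ 2.
  by rewrite {1}(_ : x = (x / 2) *+ 2) ?cos_mulr2n ?cos2sin2; [ring | field].
have := @sin_ge (x / 2); rewrite divr_ge0 // => /(_ isT) h.
(* From [x ^ 3 <= x]; it is enough since [2 * (23 / 48) ^ 2 > 1 / 3]. *)
have : 23 / 48 * x <= sin (x / 2) by nra.
nra.
Qed.

End Trigonometry.

(** * Close pairs and words *)

Section PairCounts.
Variable R : realType.

(** Grouped by the common value [k], this is [2 a b <= a ^ 2 + b ^ 2] for the numbers of indices at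
    which [u] and [v] equal [k]. *)
Lemma eq_pairs_le (T K : eqType) (s : seq T) (u v : T -> K) :
  (2 * \sum_(i <- s) \sum_(j <- s) (u i == v j) <=
   \sum_(i <- s) \sum_(j <- s) (u i == u j) +
   \sum_(i <- s) \sum_(j <- s) (v i == v j))%N.
Proof.
pose ks := undup ([seq u i | i <- s] ++ [seq v i | i <- s]).
have key (f g : T -> K) : {in s, forall i, f i \in ks} ->
    (\sum_(i <- s) \sum_(j <- s) (f i == g j) =
     \sum_(k <- ks) (\sum_(i <- s) (f i == k)) * (\sum_(j <- s) (g j == k)))%N.
  move=> fks; under [RHS]eq_bigr do rewrite big_distrl /=.
  rewrite [RHS]exchange_big /= big_seq [RHS]big_seq; apply: eq_bigr => i si.
  rewrite (bigD1_seq (f i)) ?undup_uniq ?fks //= eqxx mul1n.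
  rewrite [X in (_ + X)%N]big1 => [|k /negPf]; last first.
    by rewrite eq_sym => ->; rewrite mul0n.
  by rewrite addn0; apply: eq_bigr => j _; rewrite eq_sym.
have uks : {in s, forall i, u i \in ks}.
  by move=> i si; rewrite mem_undup mem_cat map_f.
have vks : {in s, forall i, v i \in ks}.
  by move=> i si; rewrite mem_undup mem_cat map_f ?orbT.
rewrite !key // big_distrr /= -big_split /=.
by apply: leq_sum => k _; rewrite !mulnn nat_Cauchy.
Qed.

Definition close_pairs (T : Type) (s : seq T) (f : T -> R) (r tau : R) : nat :=
  (\sum_(i <- s) \sum_(j <- s) (`|f i - f j + tau| <= r)%R)%N.

(** Cut the line into cells of length [r]. In a counted pair the cells of [f i + tau] and [f j]
    differ by -1, 0 or 1, and [eq_pairs_le] bounds each case by the pairs in a common cell, which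
    are close without shift. *)
Lemma close_pairs_shift (T : eqType) (s : seq T) (f : T -> R) (r tau : R) :
  0 < r -> (close_pairs s f r tau <= 3 * close_pairs s f r 0)%N.
Proof.
move=> r0.
pose u (i : T) := Num.floor ((f i + tau) / r).
pose v (i : T) := Num.floor (f i / r).
have same x y : Num.floor (x / r) = Num.floor (y / r) -> `|x - y| <= r.
  move=> xy; have := floor_itv (x / r); have := floor_itv (y / r); rewrite xy.
  rewrite !ler_pdivlMr // !ltr_pdivrMr // intrD mulrDl mul1r.
  by move=> /andP[y1 y2] /andP[x1 x2]; rewrite ler_norml; lra.
have key (e : int) :
    (\sum_(i <- s) \sum_(j <- s) ((u i + e)%R == v j) <=
     close_pairs s f r 0)%N.
  have /= := @eq_pairs_le T _ s (fun i => u i + e) v.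
  rewrite /close_pairs; set A := (X in (2 * X <= _)%N).
  set B := (X in (A <= X)%N).
  suff : ((\sum_(i <- s) \sum_(j <- s) ((u i + e)%R == (u j + e)%R)) +
     \sum_(i <- s) \sum_(j <- s) (v i == v j) <= B + B)%N.
    by move=> h2 h1; move: (leq_trans h1 h2); rewrite addnn -mul2n leq_pmul2l.
  rewrite leq_add //; apply: leq_sum => i _; apply: leq_sum => j _.
    have [/addIr/same|//] := eqP.
    by rewrite opprD addrACA subrr => ->.
  by have [/same|//] := eqP; rewrite addr0 => ->.
suff : (close_pairs s f r tau <=
    \sum_(i <- s) \sum_(j <- s) ((u i + (-1))%R == v j) +
    \sum_(i <- s) \sum_(j <- s) ((u i + 0)%R == v j) +
    \sum_(i <- s) \sum_(j <- s) ((u i + 1)%R == v j))%N.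
  move=> h; apply: (leq_trans h).
  by rewrite !mulSn mul0n addn0 addnA !leq_add.
rewrite -!big_split /=; apply: leq_sum => i _.
rewrite -!big_split /=; apply: leq_sum => j _.
have [hij|//] := lerP.
have := floor_itv ((f i + tau) / r); have := floor_itv (f j / r).
rewrite -/(u i) -/(v j) !ler_pdivlMr // !ltr_pdivrMr // !intrD !mulrDl !mul1r.
move=> /andP[v1 v2] /andP[u1 u2].
move: hij; rewrite ler_norml => /andP[h1 h2].
have : (u i)%:~R < (v j + 1 + 1)%:~R :> R.
  by rewrite -(ltr_pM2r r0) !intrD; lra.
have : (v j)%:~R < (u i + 1 + 1)%:~R :> R.
  by rewrite -(ltr_pM2r r0) !intrD; lra.
rewrite !ltr_int => h3 h4.
move: (u i) (v j) h3 h4 => k l h3 h4.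
have : k = l - 1 \/ k = l \/ k = l + 1 by lia.
move=> [->|[->|->]]; rewrite ?subrK ?addr0 ?addrK eqxx ?addn1 //.
Qed.

End PairCounts.

(** * Words and their expansions in base [L] *)

Section Words.
Variables (R : realType) (D : finType) (d : D -> R).
Let L := #|D|.

Fixpoint words (n : nat) : seq (seq D) :=
  if n is n'.+1 then [seq a :: w | a <- enum D, w <- words n'] else [:: [::]].

(** The base is the number of letters: [L ^ n] words at scale [L ^ -n], so the limit set has
    similarity dimension one. *)
Fixpoint point (w : seq D) : R :=
  if w is a :: w' then (d a + point w') / L%:R else 0.

Lemma big_words0 (S : Type) (idx : S) (op : Monoid.law idx) (F : seq D -> S) :
  \big[op/idx]_(w <- words 0) F w = F [::].
Proof. by rewrite big_cons big_nil Monoid.mulm1. Qed.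

Lemma big_wordsS (S : Type) (idx : S) (op : Monoid.com_law idx) n
    (F : seq D -> S) :
  \big[op/idx]_(w <- words n.+1) F w =
  \big[op/idx]_(a : D) \big[op/idx]_(w <- words n) F (a :: w).
Proof. by rewrite [LHS]big_allpairs_dep big_enum. Qed.

Lemma big_words_cat (S : Type) (idx : S) (op : Monoid.com_law idx) m n
    (F : seq D -> S) :
  \big[op/idx]_(w <- words (m + n)) F w =
  \big[op/idx]_(u <- words m) \big[op/idx]_(v <- words n) F (u ++ v).
Proof.
elim: m F => [|m IH] F; first by rewrite big_words0.
by rewrite addSn !big_wordsS; apply: eq_bigr => a _; rewrite IH.
Qed.

Lemma mem_words n w : (w \in words n) = (size w == n).
Proof.
elim: n w => [|n IH] [|a w] //=.
- by apply/allpairsP => -[[? ?] []].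
- apply/allpairsP/idP => [[[b v] /= [_ + [_ ->]]]|]; first by rewrite IH.
  by rewrite eqSS => sw; exists (a, w); rewrite /= mem_enum IH.
Qed.

Lemma uniq_words n : uniq (words n).
Proof.
elim: n => [|n IH] //=; apply: allpairs_uniq => //; first exact: enum_uniq.
by move=> [a v] [b w] _ _ /= [-> ->].
Qed.

Lemma size_words n : size (words n) = (L ^ n)%N.
Proof.
elim: n => [|n IH] //=.
by rewrite size_allpairs IH -cardE expnS.
Qed.

Lemma big_words_le m (F G : seq D -> nat) :
  (forall w, size w = m -> F w <= G w)%N ->
  (\sum_(w <- words m) F w <= \sum_(w <- words m) G w)%N.
Proof.
move=> FG; rewrite big_seq [leqRHS]big_seq; apply: leq_sum => w.
by rewrite mem_words => /eqP /FG.
Qed.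

Lemma eq_big_words (S : Type) (idx : S) (op : Monoid.com_law idx) m
    (F G : seq D -> S) :
  (forall w, size w = m -> F w = G w) ->
  \big[op/idx]_(w <- words m) F w = \big[op/idx]_(w <- words m) G w.
Proof.
move=> FG; rewrite big_seq [RHS]big_seq; apply: eq_bigr => w.
by rewrite mem_words => /eqP /FG.
Qed.

Lemma point_cat u v : point (u ++ v) = point u + L%:R ^- size u * point v.
Proof.
elim: u => [|a u IH] /=; first by rewrite add0r expr0 invr1 mul1r.
by rewrite IH addrA mulrDl exprS invfM; ring.
Qed.

End Words.

(** * Heavy words and pair counts *)

Section HeavyWords.
Variables (R : realType) (D : finType) (d : D -> R).
Local Notation L := #|D|.
Local Notation p := (point d).
Hypothesis L_ge4 : (4 <= L)%N.
Hypothesis d_le : forall a, `|d a| <= 3 / 4 * (L%:R - 1).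
Hypothesis dB_le : forall a b, `|d a - d b| <= 3 / 4 * (L%:R - 1).

Lemma base_gt0 : 0 < L%:R :> R.
Proof. by rewrite ltr0n; apply: leq_trans L_ge4. Qed.

Lemma base_exp_gt0 n : 0 < L%:R ^+ n :> R.
Proof. by rewrite exprn_gt0 ?base_gt0. Qed.

Lemma point_le w : `|p w| <= 3 / 4.
Proof.
elim: w => [|a w IH] /=; first by rewrite normr0; lra.
rewrite normrM normfV (ger0_norm (ltW base_gt0)) ler_pdivrMr ?base_gt0 //.
by apply: (le_trans (ler_normD _ _)); have := d_le a; lra.
Qed.

Lemma pointB_le w w' : size w = size w' -> `|p w - p w'| <= 3 / 4.
Proof.
elim: w w' => [|a w IH] [|b w'] //= => [_|[/IH h]].
  by rewrite subrr normr0; lra.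
rewrite -mulrBl opprD addrACA normrM normfV (ger0_norm (ltW base_gt0)).
rewrite ler_pdivrMr ?base_gt0 //.
by apply: (le_trans (ler_normD _ _)); have := dB_le a b; lra.
Qed.

Definition near (w w' : seq D) : bool := `|p w - p w'| <= L%:R ^- size w.

Definition multiplicity (w : seq D) : nat :=
  \sum_(w' <- words D (size w)) near w w'.

Definition heavy (K : nat) (w : seq D) : bool := (K <= multiplicity w)%N.

Definition has_heavy_prefix (K : nat) (w : seq D) : bool :=
  has (fun k => heavy K (take k w)) (iota 0 (size w).+1).

Definition first_heavy (K : nat) (w : seq D) : bool :=
  heavy K w && ~~ has (fun k => heavy K (take k w)) (iota 0 (size w)).

Definition nb_bad (K n : nat) : nat := \sum_(w <- words D n) has_heavy_prefix K
  w.

Definition total_multiplicity (n : nat) : nat :=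
  \sum_(w <- words D n) multiplicity w.

(** In units of the scale of [u], two suffixes of equal length differ by at most 3/4 and nearness at
    a finer level adds at most 1/4; this is why the bounds on [d] carry the factor 3/4. *)
Lemma near_prefix u u' v v' : size u = size u' -> size v = size v' ->
  near (u ++ v) (u' ++ v') -> near u u'.
Proof.
move=> su sv; rewrite /near; case: v v' sv => [|a v] [|a' v'] // sv.
  by rewrite !cats0.
rewrite !point_cat -su size_cat exprD invfM.
set x := L%:R ^- size u; set z := L%:R ^- _.
have x0 : 0 < x by rewrite invr_gt0 base_exp_gt0.
have z1 : z <= 1 / 4.
  rewrite /z div1r lef_pV2 ?posrE ?base_exp_gt0 //=.
  apply: (le_trans (_ : _ <= L%:R)); first by rewrite ler_nat.
  rewrite -[leLHS]expr1 ler_eXn2l // ?ltr1n; last exact: leq_trans L_ge4.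
have := pointB_le sv; set y := p (a :: v); set y' := p (a' :: v').
rewrite !ler_norml => /andP[h1 h2] /andP[h3 h4].
by apply/andP; split; nra.
Qed.

Lemma close_pairs_total n :
  close_pairs (words D n) p (L%:R ^- n) 0 = total_multiplicity n.
Proof.
rewrite /total_multiplicity /close_pairs; apply: eq_big_words => w sw.
by rewrite /multiplicity sw; apply: eq_bigr => w' _; rewrite /near sw addr0.
Qed.

(** Near words have near prefixes. For each [u'] near [u], scaling by [L ^ size u] turns the near
    extensions into close pairs of level [n] with a shift, which costs the factor 3. *)
Lemma sum_multiplicity_cat u n :
  (\sum_(v <- words D n) multiplicity (u ++ v) <=
   3 * (multiplicity u * total_multiplicity n))%N.
Proof.
rewrite /multiplicity.
have -> : (\sum_(v <- words D n) \sum_(w' <- words D (size (u ++ v)))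
    near (u ++ v) w')%N = (\sum_(u' <- words D (size u)) \sum_(v <- words D n)
    \sum_(v' <- words D n) near (u ++ v) (u' ++ v'))%N.
  rewrite [RHS]exchange_big; apply: eq_big_words => v sv.
  by rewrite size_cat sv big_words_cat.
rewrite mulnCA big_distrl /=; apply: big_words_le => u' su'.
apply: (@leq_trans (near u u' * close_pairs (words D n) p (L%:R ^- n)
  (L%:R ^+ size u * (p u - p u')))).
  case: (boolP (near u u')) => [_|nuu'].
    rewrite mul1n; apply: big_words_le => v sv; apply: big_words_le => v' sv'.
    rewrite /near !point_cat su' size_cat sv exprD.
    set c := L%:R ^+ size u; set e := L%:R ^+ n.
    have c0 : 0 < c by exact: base_exp_gt0.
    rewrite invfM (_ : _ + _ - _ = c^-1 * (p v - p v' + c * (p u - p u'))).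
      by rewrite normrM normfV (gtr0_norm c0) ler_pM2l ?invr_gt0.
    by rewrite mulrDr mulKf ?gt_eqF //; ring.
  rewrite mul0n leqn0 big_seq big1 // => v; rewrite mem_words => /eqP sv.
  rewrite big_seq big1 // => v'; rewrite mem_words => /eqP sv'.
  apply/eqP; rewrite eqb0; apply: contra nuu'.
  by apply: near_prefix; rewrite ?su' ?sv ?sv'.
rewrite leq_mul2l -close_pairs_total close_pairs_shift ?orbT //.
by rewrite invr_gt0 base_exp_gt0.
Qed.

Lemma multiplicity_rcons u a :
  (multiplicity (rcons u a) <= L * multiplicity u)%N.
Proof.
rewrite /multiplicity size_rcons -addn1 big_words_cat big_distrr /=.
apply: big_words_le => u' su'; rewrite (big_wordsS _ 0%N).
apply: (@leq_trans (\sum_(b : D) near u u')).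
  apply: leq_sum => b _; rewrite big_words0 -cats1.
  by case: (boolP (near _ _)) => // /near_prefix ->.
by rewrite sum_nat_const.
Qed.

(** Only the shortest heavy prefix is a first heavy one; the sum form lets words be split there. *)
Lemma has_heavy_prefix_sum K w :
  has_heavy_prefix K w =
  (\sum_(k < (size w).+1) first_heavy K (take k w))%N :> nat.
Proof.
transitivity (\sum_(0 <= k < (size w).+1) first_heavy K (take k w))%N;
  last first.
  by rewrite big_mkord.
rewrite /has_heavy_prefix.
have : ((size w).+1 <= (size w).+1)%N by [].
elim: {1 3 4}(size w).+1 => [|n IH] nw; first by rewrite big_nil.
rewrite big_nat_recr // -IH ?(ltnW nw) //.
have -> : iota 0 n.+1 = iota 0 n ++ [:: n] by rewrite -addn1 iotaD.
rewrite has_cat /= orbF.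
rewrite /first_heavy size_take_min (minn_idPl _) // -/(heavy K (take n w)).
have -> : has (fun k => heavy K (take k (take n w))) (iota 0 n) =
          has (fun k => heavy K (take k w)) (iota 0 n).
  apply: eq_in_has => k; rewrite mem_iota /= add0n => kn.
  by rewrite take_takel // ltnW.
by case: has; case: heavy.
Qed.

Lemma multiplicity_nil : multiplicity [::] = 1%N.
Proof. by rewrite /multiplicity big_words0 /near subrr normr0 expr0 invr1
  ler01. Qed.

(** The parent of [u] is not heavy and one more letter costs a factor [L]. The empty word has
    multiplicity 1, so [1 < K] excludes it. *)
Lemma multiplicity_first_heavy K u : (1 < K)%N ->
  first_heavy K u -> (0 < size u)%N /\ (multiplicity u <= L * K)%N.
Proof.
move=> K1; case/lastP: u => [|u a] /andP[hu nu].
  by move: hu; rewrite /heavy multiplicity_nil leqNgt K1.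
rewrite size_rcons; split=> //; apply: (leq_trans (multiplicity_rcons u a)).
rewrite leq_mul2l ltnW ?orbT // ltnNge; apply: contra nu => hu'.
apply/hasP; exists (size u); first by rewrite size_rcons mem_iota add0n /=.
by rewrite -cats1 take_size_cat.
Qed.

Lemma has_heavy_prefix_cat K u v :
  has_heavy_prefix K u -> has_heavy_prefix K (u ++ v).
Proof.
move=> /hasP[k]; rewrite mem_iota add0n /= ltnS => ku hk.
apply/hasP; exists k; last by rewrite takel_cat.
by rewrite mem_iota add0n /= ltnS size_cat (leq_trans ku) ?leq_addr.
Qed.

Lemma nb_bad_mul K m n : (nb_bad K m * L ^ n <= nb_bad K (m + n))%N.
Proof.
rewrite /nb_bad big_words_cat big_distrl /=; apply: leq_sum => u _.
rewrite -size_words mulnC -sum1_size big_distrl /=; apply: leq_sum => v _.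
rewrite mul1n; case: (boolP (has_heavy_prefix K u)) => // hu.
by rewrite has_heavy_prefix_cat.
Qed.

(* Self-similarity at the first heavy prefix [u]: above [u] there are at most
   [L * K] cylinders, and the pairs inside each two of them are counted by
   [close_pairs_shift]. *)
Lemma total_multiplicity_le K N : (1 < K)%N ->
  (6 * L * K * nb_bad K N <= L ^ N)%N ->
  forall n, (n <= N)%N -> (total_multiplicity n <= 2 * K * L ^ n)%N.
Proof.
move=> K1 hN; elim/ltn_ind => n IH nN.
(* Extensions of bad words are bad, so the bad proportion at level [n] is at most that at level
   [N]. *)
have hn : (6 * L * K * nb_bad K n <= L ^ n)%N.
  rewrite -(leq_pmul2r (_ : 0 < L ^ (N - n))%N) ?expn_gt0 ?(leq_trans _ L_ge4)
    //.
  rewrite -expnD subnKC // -mulnA (leq_trans _ hN) // leq_mul2l.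
  by rewrite (leq_trans (nb_bad_mul _ _ _)) ?subnKC ?orbT.
have step1 : (total_multiplicity n <= K * L ^ n +
    \sum_(w <- words D n) has_heavy_prefix K w * multiplicity w)%N.
  rewrite -size_words mulnC -sum1_size big_distrl /= -big_split /=.
  apply: leq_sum => w _; rewrite mul1n; case: (boolP (has_heavy_prefix K w)).
    by rewrite mul1n leq_addl.
  rewrite mul0n addn0 => /hasPn/(_ (size w)); rewrite mem_iota add0n /= ltnS.
  by rewrite take_size leqnn /heavy -ltnNge => /(_ isT)/ltnW.
have step2 : (\sum_(w <- words D n) has_heavy_prefix K w * multiplicity w =
    \sum_(k < n.+1) \sum_(u <- words D k) \sum_(v <- words D (n - k))
      first_heavy K u * multiplicity (u ++ v))%N.
  under [LHS]eq_big_words => w sw.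
    rewrite has_heavy_prefix_sum sw big_distrl /=; over.
  rewrite exchange_big /=; apply: eq_bigr => k _.
  have kn : (k <= n)%N by rewrite -ltnS ltn_ord.
  rewrite -{1}(subnKC kn) big_words_cat; apply: eq_big_words => u su.
  by apply: eq_bigr => v _; rewrite take_size_cat.
have step3 : (nb_bad K n =
    \sum_(k < n.+1) \sum_(u <- words D k) first_heavy K u * L ^ (n - k))%N.
  rewrite /nb_bad; under [LHS]eq_big_words => w sw.
    rewrite has_heavy_prefix_sum sw; over.
  rewrite exchange_big /=; apply: eq_bigr => k _.
  have kn : (k <= n)%N by rewrite -ltnS ltn_ord.
  rewrite -{1}(subnKC kn) big_words_cat; apply: eq_big_words => u su.
  rewrite -size_words mulnC -sum1_size big_distrl /=.
  by apply: eq_bigr => v _; rewrite mul1n take_size_cat.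
apply: (leq_trans step1); rewrite mul2n -addnn mulnDl leq_add2l step2.
(* A first heavy [u] of length [k] contributes at most [3 * (L K) * (2 K L ^ (n - k))], that is
   [K * 6 L K] per extension; hence the constant in the hypothesis. *)
apply: (@leq_trans (K * (6 * L * K * nb_bad K n)));
  last by rewrite leq_mul2l hn orbT.
rewrite step3 !big_distrr /=; apply: leq_sum => k _.
rewrite !big_distrr /=; apply: big_words_le => u su.
case: (boolP (first_heavy K u)) => [fu|_]; last first.
  by rewrite big1 // => v _; rewrite mul0n.
have [u0 mu] := multiplicity_first_heavy K1 fu.
under eq_bigr do rewrite mul1n.
apply: (leq_trans (sum_multiplicity_cat _ _)); rewrite mul1n.
have kn : (k <= n)%N by rewrite -ltnS ltn_ord.
have k0 : (0 < k)%N by rewrite -su.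
have := IH (n - k)%N; rewrite -subn_gt0 subKn // => /(_ k0).
rewrite (leq_trans (leq_subr _ _)) // => /(_ isT) hQ.
apply: (@leq_trans (3 * (L * K * (2 * K * L ^ (n - k))))).
  by rewrite leq_mul2l leq_mul.
by rewrite eq_leq //; ring.
Qed.

End HeavyWords.

(** * Fourier bounds *)

Section Fourier.
Variables (R : realType) (D : finType) (d : D -> R).
Local Notation L := #|D|.
Local Notation p := (point d).
Hypothesis L_ge4 : (4 <= L)%N.
Hypothesis dB_le : forall a b, `|d a - d b| <= 3 / 4 * (L%:R - 1).
Hypothesis d_cos : forall x, 1 <= cos_sq_sum (enum D) d x.

(** [|mu_hat x| ^ 2] for the probability measure [mu] giving equal mass to all words of length [n],
    placed at their points. *)
Definition energy (n : nat) (x : R) : R :=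
  cos_sq_sum (words D n) p x / L%:R ^+ n ^+ 2.

Let Lx_gt0 n : 0 < L%:R ^+ n :> R := base_exp_gt0 R L_ge4 n.

(** A point of level [m + n] is one of level [m] plus a scaled one of level [n], so the exponential
    sum factors. *)
Lemma cos_sq_sum_words_add m n x :
  cos_sq_sum (words D (m + n)) p x =
  cos_sq_sum (words D m) p x * cos_sq_sum (words D n) p (x / L%:R ^+ m).
Proof.
rewrite /cos_sq_sum !big_words_cat.
set c := \sum_(w <- words D m) cos _; set s := \sum_(w <- words D m) sin _.
set c' := \sum_(w <- words D n) cos _; set s' := \sum_(w <- words D n) sin _.
have E u v : size u = m ->
    p (u ++ v) * x = p u * x + p v * (x / L%:R ^+ m).
  by move=> su; rewrite point_cat su; ring.
have -> : \sum_(u <- words D m) \sum_(v <- words D n) cos (p (u ++ v) * x) =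
    c * c' - s * s'.
  rewrite /c /s /c' /s' !big_distrl /= -sumrB; apply: eq_big_words => u su.
  rewrite !big_distrr /= -sumrB; apply: eq_bigr => v _.
  by rewrite E // cosD.
have -> : \sum_(u <- words D m) \sum_(v <- words D n) sin (p (u ++ v) * x) =
    s * c' + c * s'.
  rewrite /c /s /c' /s' !big_distrl /= -big_split; apply: eq_big_words => u su.
  rewrite /= !big_distrr /= -big_split; apply: eq_bigr => v _.
  by rewrite E // sinD.
by ring.
Qed.

Lemma cos_sq_sum_words1 x :
  cos_sq_sum (words D 1) p x = cos_sq_sum (enum D) d (x / L%:R).
Proof.
rewrite /cos_sq_sum !(big_wordsS _ 0%N) !big_enum /=.
by congr (_ ^+ 2 + _ ^+ 2); apply: eq_bigr => a _;
  rewrite big_words0 /= addr0 mulrAC mulrA.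
Qed.

Lemma cos_sq_sum_words_ge1 n x : 1 <= cos_sq_sum (words D n) p x.
Proof.
elim: n x => [|n IH] x.
  rewrite /cos_sq_sum !big_words0 /= mul0r cos0 sin0; lra.
rewrite -add1n cos_sq_sum_words_add cos_sq_sum_words1.
by rewrite -[1]mulr1 ler_pM.
Qed.

Lemma energyD m n x : energy (m + n) x = energy m x * energy n (x / L%:R ^+ m).
Proof.
rewrite /energy cos_sq_sum_words_add exprD.
by move: (Lx_gt0 m) (Lx_gt0 n) => /lt0r_neq0 ? /lt0r_neq0 ?; field; apply/andP.
Qed.

Lemma energy_ge0 n x : 0 <= energy n x.
Proof. by rewrite divr_ge0 ?cos_sq_sum_ge0 ?sqr_ge0. Qed.

Lemma energy_lower n x : (L%:R ^+ n ^+ 2)^-1 <= energy n x.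
Proof.
by rewrite -[leLHS]mul1r ler_pM2r ?cos_sq_sum_words_ge1 // invr_gt0 exprn_gt0.
Qed.

Lemma energyN n x : energy n (- x) = energy n x.
Proof.
rewrite /energy !cos_sq_sumE; congr (_ / _).
by do 2!(apply: eq_bigr => ? _); rewrite mulrN cosN.
Qed.

(** Points differ by at most 3/4, so every cosine in the double sum is at least 1/2. *)
Lemma energy_ge_half n x : `|x| <= 1 -> 1 / 2 <= energy n x.
Proof.
move=> x1; rewrite /energy ler_pdivlMr ?(exprn_gt0 2 (Lx_gt0 n)) // cos_sq_sumE.
have -> : 1 / 2 * L%:R ^+ n ^+ 2 =
    \sum_(w <- words D n) \sum_(w' <- words D n) (1 / 2 : R).
  rewrite !big_const_seq !iter_addr_0 !count_predT size_words -mulrnA.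
  by rewrite -[RHS]mulr_natr natrM natrX expr2.
rewrite big_seq [leRHS]big_seq; apply: ler_sum => w.
rewrite mem_words => /eqP sw.
rewrite big_seq [leRHS]big_seq; apply: ler_sum => w'.
rewrite mem_words => /eqP sw'; apply: le_trans (cos_ge _).
have := pointB_le L_ge4 dB_le (etrans sw (esym sw')).
rewrite ler_norml => /andP[y1 y2]; move: x1; rewrite ler_norml => /andP[x1 x2].
have hx : x ^+ 2 <= 1 by nra.
have hy : (p w - p w') ^+ 2 <= 1 by nra.
by rewrite exprMn; have := ler_pM (sqr_ge0 _) (sqr_ge0 _) hy hx; lra.
Qed.

(** The squared modulus of the geometric sum of [J] exponentials, that is [J] times the Fejer
    kernel. *)
Definition dirichlet (J : nat) (x : R) : R :=
  cos_sq_sum (index_iota 0 J) (fun j => j%:R) x.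

(** Duality: both sides sum the cosines of [(p w - p w') * (j - j')], in two orders. *)
Lemma sum_energy_diff n J :
  \sum_(0 <= j < J) \sum_(0 <= j' < J) energy n (j%:R - j'%:R) =
  (\sum_(w <- words D n) \sum_(w' <- words D n) dirichlet J (p w - p w')) /
    L%:R ^+ n ^+ 2.
Proof.
transitivity (\sum_(0 <= j < J) \sum_(0 <= j' < J)
    \sum_(w <- words D n) \sum_(w' <- words D n)
      cos ((p w - p w') * (j%:R - j'%:R)) / L%:R ^+ n ^+ 2).
  apply: eq_bigr => j _; apply: eq_bigr => j' _.
  rewrite /energy cos_sq_sumE big_distrl; apply: eq_bigr => w _.
  by rewrite big_distrl.
transitivity (\sum_(0 <= j < J) \sum_(w <- words D n)
    \sum_(w' <- words D n) \sum_(0 <= j' < J)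
      cos ((p w - p w') * (j%:R - j'%:R)) / L%:R ^+ n ^+ 2).
  apply: eq_bigr => j _; rewrite exchange_big; apply: eq_bigr => w _.
  by rewrite exchange_big.
rewrite exchange_big big_distrl; apply: eq_bigr => w _ /=.
rewrite exchange_big big_distrl; apply: eq_bigr => w' _ /=.
rewrite /dirichlet cos_sq_sumE big_distrl; apply: eq_bigr => j _ /=.
by rewrite big_distrl; apply: eq_bigr => j' _; rewrite [X in cos X]mulrC.
Qed.

Lemma dirichlet_ge0 J x : 0 <= dirichlet J x.
Proof. exact: cos_sq_sum_ge0. Qed.

Lemma dirichlet_le J x : dirichlet J x <= J%:R ^+ 2.
Proof.
rewrite /dirichlet cos_sq_sumE.
apply: (@le_trans _ _ (\sum_(0 <= i < J) \sum_(0 <= j < J) 1)).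
  by do 2!(apply: ler_sum => ? _); exact: cos_le1.
rewrite !big_const_seq !iter_addr_0 !count_predT size_iota subn0 -mulrnA.
by rewrite -natrX mulnn.
Qed.

Lemma dirichlet0 J : dirichlet J 0 = J%:R ^+ 2.
Proof.
rewrite /dirichlet cos_sq_sumE.
under eq_bigr => i _ do under eq_bigr => j _ do rewrite mulr0 cos0.
rewrite !big_const_seq !iter_addr_0 !count_predT size_iota subn0 -mulrnA.
by rewrite -natrX mulnn.
Qed.

(* The geometric sum [(e^(iJx) - 1) / (e^(ix) - 1)], squared. *)
Lemma dirichlet_mul J x :
  dirichlet J x * (2 - 2 * cos x) = 2 - 2 * cos (J%:R * x).
Proof.
pose c n := \sum_(0 <= j < n) cos (j%:R * x).
pose s n := \sum_(0 <= j < n) sin (j%:R * x).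
have cS n : c n.+1 = c n + cos (n%:R * x).
  by rewrite /c big_nat_recr.
have sS n : s n.+1 = s n + sin (n%:R * x).
  by rewrite /s big_nat_recr.
have e1 n : c n * (cos x - 1) - s n * sin x = cos (n%:R * x) - 1.
  elim: n => [|n IH].
    by rewrite /c /s !big_geq // !mul0r cos0 !subrr.
  rewrite cS sS -natr1 [in RHS]mulrDl mul1r cosD.
  transitivity (c n * (cos x - 1) - s n * sin x +
    (cos (n%:R * x) * (cos x - 1) - sin (n%:R * x) * sin x)); first by ring.
  by rewrite IH; ring.
have e2 n : s n * (cos x - 1) + c n * sin x = sin (n%:R * x).
  elim: n => [|n IH].
    by rewrite /c /s !big_geq // !mul0r sin0 addr0.
  rewrite cS sS -natr1 [in RHS]mulrDl mul1r sinD.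
  transitivity (s n * (cos x - 1) + c n * sin x +
    (sin (n%:R * x) * (cos x - 1) + cos (n%:R * x) * sin x)); first by ring.
  by rewrite IH; ring.
rewrite /dirichlet /cos_sq_sum -/(c J) -/(s J).
have -> : 2 - 2 * cos x = (cos x - 1) ^+ 2 + sin x ^+ 2.
  by rewrite sin2cos2; ring.
have -> : 2 - 2 * cos (J%:R * x) = (cos (J%:R * x) - 1) ^+ 2 + sin (J%:R * x)
  ^+ 2.
  by rewrite sin2cos2; ring.
by rewrite -e1 -e2; ring.
Qed.

Lemma sum_subrange_le (f : nat -> R) (a b c : nat) :
  (forall k, 0 <= f k) -> (b <= c)%N ->
  \sum_(a <= k < b) f k <= \sum_(0 <= k < c) f k.
Proof.
move=> f0 bc; have [ab|ba] := leqP a b; last first.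
  by rewrite big_geq ?sumr_ge0 // ltnW.
rewrite (big_cat_nat (leq0n a)) /= ?(leq_trans ab) //.
rewrite [X in _ <= _ + X](big_cat_nat ab) //= addrCA lerDl.
by rewrite addr_ge0 ?sumr_ge0.
Qed.

(** With truncated subtraction [(j - k) + (k - j)] is [|j - k|], and each value is taken at most
    twice. *)
Lemma sum_abs_diff_le (f : nat -> R) (J j : nat) :
  (forall k, 0 <= f k) -> (j < J)%N ->
  \sum_(0 <= k < J) f ((j - k) + (k - j))%N <= 2 * \sum_(0 <= k < J) f k.
Proof.
move=> f0 jJ; rewrite (big_cat_nat (leq0n j)) ?(ltnW jJ) //= mulr_natl mulr2n.
apply: lerD.
  rewrite big_nat_rev /= big_nat.
  rewrite (eq_bigr (fun k => f k.+1)) => [|k kj]; last by congr f; lia.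
  by rewrite -big_nat -(big_add1 _ _ 0 j.+1 xpredT f) sum_subrange_le.
rewrite -{1}[j]add0n big_addn.
rewrite (eq_bigr f) => [|k _]; last by congr f; lia.
by rewrite sum_subrange_le // leq_subr.
Qed.

(** In the dual form the diagonal [w = w'] alone gives [L ^ n * J ^ 2], while by evenness of the
    energy each row [j] is at most [2 * S]. *)
Lemma sum_energy_ge n J : (0 < J)%N ->
  J%:R / (2 * L%:R ^+ n) <= \sum_(0 <= k < J) energy n k%:R.
Proof.
move=> J0; set S := \sum_(0 <= k < J) _.
have JR : 0 < J%:R :> R by rewrite ltr0n.
have Ln0 := Lx_gt0 n.
have upper : \sum_(0 <= j < J) \sum_(0 <= j' < J) energy n (j%:R - j'%:R) <=
    J%:R * (2 * S).
  apply: (@le_trans _ _ (\sum_(0 <= j < J) 2 * S)); last first.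
    by rewrite sumr_const_nat subn0 [leRHS]mulr_natl.
  apply: ler_sum_nat => j /andP[_ jJ].
  rewrite (eq_bigr (fun k => energy n ((j - k) + (k - j))%N%:R)) => [|k _].
    by apply: sum_abs_diff_le => // k; exact: energy_ge0.
  have [kj|/ltnW jk] := leqP k j.
    by rewrite (eqP kj) addn0 natrB.
  by rewrite -opprB energyN (eqP jk) add0n natrB.
have lower : L%:R ^+ n * J%:R ^+ 2 <=
    \sum_(w <- words D n) \sum_(w' <- words D n) dirichlet J (p w - p w').
  rewrite -natrX -size_words mulr_natl -[leLHS]iter_addr_0 -count_predT.
  rewrite -big_const_seq big_seq [leRHS]big_seq; apply: ler_sum => w nw.
  rewrite (bigD1_seq w) ?uniq_words //= subrr dirichlet0 lerDl sumr_ge0 // =>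
    w' _.
  exact: dirichlet_ge0.
move: upper; rewrite sum_energy_diff ler_pdivrMr ?(exprn_gt0 2 Ln0) // => upper.
have := le_trans lower upper; move: (L%:R ^+ n) Ln0 => l l0.
rewrite ler_pdivrMr; last lra.
rewrite (_ : l * _ = l * J%:R * J%:R); last by ring.
rewrite (_ : _ * l ^+ 2 = l * J%:R * (S * (2 * l))); last by ring.
by rewrite ler_pM2l // mulr_gt0.
Qed.

(** For each [j' < J] the differences [j - j'] with [j < 2 J] include all of [0, ..., J - 1]. *)
Lemma sum_energy_le_diff n J :
  J%:R * (\sum_(0 <= k < J) energy n k%:R) <=
  \sum_(0 <= j < J.*2) \sum_(0 <= j' < J.*2) energy n (j%:R - j'%:R).
Proof.
rewrite exchange_big_nat /=.
apply: (@le_trans _ _ (\sum_(0 <= j' < J) \sum_(0 <= j < J.*2)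
    energy n (j%:R - j'%:R))); last first.
  apply: (sum_subrange_le (f := fun j' => \sum_(0 <= j < J.*2) energy n (j%:R -
    j'%:R))); last lia.
  by move=> k; rewrite sumr_ge0 // => j _; exact: energy_ge0.
rewrite mulr_natl -[J in _ *+ J]subn0 -sumr_const_nat;
  apply: ler_sum_nat => j' /andP[_ jJ].
apply: (@le_trans _ _ (\sum_(j' <= j < J + j') energy n (j%:R - j'%:R))).
  rewrite -{1}[j']add0n big_addn addnK; apply: ler_sum => k _.
  by rewrite natrD addrK.
apply: (sum_subrange_le (f := fun j => energy n (j%:R - j'%:R))); last lia.
by move=> k; exact: energy_ge0.
Qed.

(** Only the term where [i] is the integer part of [|x| J] is kept. Its weight comes from the
    trivial bound [(2 J) ^ 2] if [i = 0], and otherwise from the bound [6 / x ^ 2] and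
    [i + 1 <= 2 |x| J]. *)
Lemma dirichlet_le_weights J (x : R) : (0 < J)%N -> `|x| <= 3 / 4 ->
  dirichlet J.*2 x <= \sum_(0 <= i < J.+1) 24 * J%:R ^+ 2 / i.+1%:R ^+ 2 *
    ((`|x - i%:R / J%:R| <= J%:R^-1)%R + (`|x + i%:R / J%:R| <=
      J%:R^-1)%R)%N%:R.
Proof.
move=> J0 x1.
have JR : 0 < J%:R :> R by rewrite ltr0n.
pose i := Num.truncn (`|x| * J%:R).
have /andP[i1 i2] : i%:R <= `|x| * J%:R < i.+1%:R by rewrite truncn_itv
  ?mulr_ge0.
have iJ : (i <= J)%N by rewrite -(ler_nat R) (le_trans i1) //; nra.
apply: (le_trans _ (@sum_subrange_le _ i i.+1 J.+1 _ _)) => //=.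
rewrite big_nat1.
have ind : (1 <= ((`|x - i%:R / J%:R| <= J%:R^-1)%R +
    (`|x + i%:R / J%:R| <= J%:R^-1)%R))%N.
  have E : `| `|x| - i%:R / J%:R| <= J%:R^-1.
    rewrite -natr1 in i2.
    rewrite -(ler_pM2r JR) mulVf ?gt_eqF // -[X in _ * X](gtr0_norm JR) -normrM.
    by rewrite mulrBl divfK ?gt_eqF // ler_norml; lra.
  have [x0|x0] := leP 0 x; move: E; first by rewrite (ger0_norm x0) => ->.
  by rewrite (ltr0_norm x0) -opprD normrN => ->; rewrite addn1.
apply: (@le_trans _ _ (24 * J%:R ^+ 2 / i.+1%:R ^+ 2)); last first.
  by rewrite ler_peMr ?divr_ge0 ?mulr_ge0 ?sqr_ge0 // ler1n.
rewrite ler_pdivlMr ?exprn_gt0 //.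
have d0 := dirichlet_ge0 J.*2 x; have d1 := dirichlet_le J.*2 x.
have [i0|i0] := posnP i.
  rewrite i0 expr1n mulr1; move: d1; rewrite -muln2 natrM; nra.
have d2 := dirichlet_mul J.*2 x.
have c1 := cos_geN1 (J.*2%:R * x).
have c2 : x ^+ 2 / 3 <= 1 - cos x by apply: one_sub_cos_ge; lra.
move: (dirichlet J.*2 x) d0 d1 d2 => dd d0 d1 d2.
have d3 : dd * x ^+ 2 <= 6 by nra.
have i3 : i.+1%:R ^+ 2 <= 4 * (x ^+ 2 * J%:R ^+ 2).
  rewrite -[x ^+ 2]ger0_norm ?sqr_ge0 // normrX -exprMn.
  have : (1 : R) <= i%:R by rewrite ler1n.
  by rewrite -natr1; nra.
apply: (le_trans (ler_wpM2l d0 i3)).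
by have := ler_wpM2r (sqr_ge0 (J%:R : R)) d3; lra.
Qed.

Lemma sum_inv_sq_le n : \sum_(0 <= i < n) (i.+1%:R ^+ 2)^-1 <= 2 :> R.
Proof.
(* Strengthened so that the induction telescopes. *)
suff : \sum_(0 <= i < n.+1) (i.+1%:R ^+ 2)^-1 <= 2 - n.+1%:R^-1 :> R.
  move=> h; apply: le_trans (le_trans h _); last by rewrite gerBl.
  by apply: sum_subrange_le => // k; rewrite invr_ge0 sqr_ge0.
elim: n => [|n IH]; first by rewrite big_nat1 expr1n invr1; lra.
rewrite big_nat_recr //=; apply: (le_trans (lerD IH (lexx _))).
have a0 : 0 < n.+1%:R :> R by [].
rewrite -[n.+2%:R]natr1; move: n.+1%:R a0 => a a0.
rewrite -subr_ge0 (_ : _ - _ = (a * (a + 1) ^+ 2)^-1).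
  by rewrite invr_ge0 mulr_ge0 ?sqr_ge0 // ltW.
by field; apply/andP; split; lra.
Qed.

(** Each [i] counts close pairs for two shifts, each at most 3 times the unshifted count; the
    weights add up to at most [48 J ^ 2], and [6 * 48 = 288]. *)
Lemma sum_dirichlet_le n (J := (L ^ n)%N) :
  \sum_(w <- words D n) \sum_(w' <- words D n) dirichlet J.*2 (p w - p w') <=
  288 * J%:R ^+ 2 * (total_multiplicity d n)%:R.
Proof.
have J0 : (0 < J)%N by rewrite expn_gt0 (leq_trans _ L_ge4).
have JE : L%:R ^- n = J%:R^-1 :> R by rewrite natrX.
pose W i : R := 24 * J%:R ^+ 2 / i.+1%:R ^+ 2.
have W0 i : 0 <= W i by rewrite divr_ge0 ?mulr_ge0 ?sqr_ge0.
apply: (@le_trans _ _ (\sum_(w <- words D n) \sum_(w' <- words D n)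
  \sum_(0 <= i < J.+1) W i * ((`|p w - p w' + - (i%:R / J%:R)| <= J%:R^-1)%R +
     (`|p w - p w' + i%:R / J%:R| <= J%:R^-1)%R)%N%:R)).
  rewrite big_seq [leRHS]big_seq; apply: ler_sum => w.
  rewrite mem_words => /eqP sw.
  rewrite big_seq [leRHS]big_seq; apply: ler_sum => w'.
  rewrite mem_words => /eqP sw'; apply: dirichlet_le_weights => //.
  by apply: pointB_le => //; rewrite sw sw'.
apply: (@le_trans _ _ (\sum_(0 <= i < J.+1) W i *
    (close_pairs (words D n) p J%:R^-1 (- (i%:R / J%:R)) +
     close_pairs (words D n) p J%:R^-1 (i%:R / J%:R))%N%:R)).
  under eq_bigr => w _ do rewrite exchange_big /=.
  rewrite exchange_big /=; apply: ler_sum => i _.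
  rewrite -big_split /= natr_sum big_distrr /=; apply: ler_sum => w _.
  by rewrite -big_split /= natr_sum big_distrr.
apply: (@le_trans _ _ (\sum_(0 <= i < J.+1) W i *
    (6 * (total_multiplicity d n)%:R))).
  apply: ler_sum => i _; rewrite ler_wpM2l // -natrM ler_nat.
  have Jr : 0 < J%:R^-1 :> R by rewrite invr_gt0 ltr0n.
  have h tau := close_pairs_shift (words D n) p tau Jr.
  rewrite -close_pairs_total // JE.
  by have := leq_add (h (- (i%:R / J%:R))) (h (i%:R / J%:R)); rewrite -mulnDl.
rewrite -big_distrl /= /W -big_distrr /=.
have := sum_inv_sq_le J.+1; set s := \sum_(0 <= i < J.+1) _ => s2.
have T0 : 0 <= (total_multiplicity d n)%:R :> R by [].
have := mulr_ge0 (sqr_ge0 (J%:R : R)) T0; nra.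
Qed.

Lemma sum_energy_le n K (J := (L ^ n)%N) :
  (total_multiplicity d n <= 2 * K * J)%N ->
  \sum_(0 <= k < J) energy n k%:R <= 576 * K%:R.
Proof.
move=> hT; have J0 : (0 < J)%N by rewrite expn_gt0 (leq_trans _ L_ge4).
have JR : 0 < J%:R :> R by rewrite ltr0n.
have := sum_energy_le_diff n J; rewrite sum_energy_diff.
have := sum_dirichlet_le n; rewrite -/J -natrX -/J => h1 h2.
have h3 : (total_multiplicity d n)%:R <= 2 * K%:R * J%:R :> R.
  by rewrite -!natrM ler_nat.
rewrite -(ler_pM2l JR); apply: (le_trans h2).
rewrite ler_pdivrMr ?exprn_gt0 //; apply: (le_trans h1).
apply: le_trans (_ : 288 * J%:R ^+ 2 * (2 * K%:R * J%:R) <= _).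
  by rewrite ler_wpM2l // mulr_ge0 ?sqr_ge0.
by lra.
Qed.

End Fourier.

(** * Frequency windows and the proportion of bad words *)

Section Density.
Variables (R : realType) (D : finType) (d : D -> R).
Local Notation L := #|D|.
Local Notation p := (point d).
Hypothesis L_ge4 : (4 <= L)%N.
Hypothesis dB_le : forall a b, `|d a - d b| <= 3 / 4 * (L%:R - 1).
Hypothesis d_cos : forall x, 1 <= cos_sq_sum (enum D) d x.

Lemma energy_ge_prefix a b x : `|x| <= L%:R ^+ a ->
  energy d a x <= 2 * energy d (a + b) x.
Proof.
move=> xa; rewrite energyD //.
have : 1 / 2 <= energy d b (x / L%:R ^+ a).
  apply: energy_ge_half => //.
  by rewrite normrM normfV (gtr0_norm (base_exp_gt0 _ _ _)) // ler_pdivrMr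
    ?base_exp_gt0 // mul1r.
have := energy_ge0 d a x; move: (energy d a x) (energy d b _) => e e'; nra.
Qed.

(** At level [a] the frequencies below [L ^ (a + m)] carry at least [L ^ m / 2], and those below
    [L ^ a] at most [2 * 576 K <= L ^ m / 4]; hence 4608. Passing to level [a + m] costs at most
    [L ^ (2 m)] by [energy_lower], and to the last level at most 2. *)
Lemma window_energy_ge K a m b :
  (4608 * K <= L ^ m)%N ->
  \sum_(0 <= k < L ^ (a + m + b)) energy d (a + m + b) k%:R <= 576 * K%:R ->
  (8 * L%:R ^+ m)^-1 <=
    \sum_(L ^ a <= k < L ^ (a + m)) energy d (a + m + b) k%:R.
Proof.
move=> Km hN.
have L0 : (0 < L)%N by apply: leq_trans L_ge4.
have KmR : 4608 * K%:R <= L%:R ^+ m :> R by rewrite -natrX -natrM ler_nat.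
have la := base_exp_gt0 R L_ge4 a; have lm := base_exp_gt0 R L_ge4 m.
have aam : (L ^ a <= L ^ (a + m))%N by rewrite leq_pexp2l ?leq_addr.
have aN : (L ^ a <= L ^ (a + m + b))%N.
  by rewrite leq_pexp2l // -addnA leq_addr.
have := @sum_energy_ge _ _ d L_ge4 a (L ^ (a + m));
  rewrite expn_gt0 L0 => /(_ isT).
rewrite (big_cat_nat (leq0n (L ^ a))) //=.
rewrite (_ : _ / _ = L%:R ^+ m / 2); last first.
  by rewrite expnD natrM !natrX; field; rewrite gt_eqF.
have low : \sum_(0 <= k < L ^ a) energy d a k%:R <= L%:R ^+ m / 4.
  apply: (@le_trans _ _ (2 * (576 * K%:R))); last by lra.
  apply: le_trans (ler_wpM2l _ hN) => //.
  apply: le_trans (ler_wpM2l _ (sum_subrange_le 0 _ aN)) => // [|k];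
    last exact: energy_ge0.
  rewrite mulr_sumr; apply: ler_sum_nat => k /andP[_ ka].
  rewrite -addnA energy_ge_prefix // normr_nat -natrX ler_nat ltnW //.
have high : \sum_(L ^ a <= k < L ^ (a + m)) energy d a k%:R <=
    2 * L%:R ^+ m ^+ 2 *
      \sum_(L ^ a <= k < L ^ (a + m)) energy d (a + m + b) k%:R.
  rewrite mulr_sumr; apply: ler_sum_nat => k /andP[_ ka].
  rewrite mulrAC.
  apply: (@le_trans _ _ (energy d (a + m) k%:R * L%:R ^+ m ^+ 2)); last first.
    rewrite ler_wpM2r ?sqr_ge0 // energy_ge_prefix // normr_nat -natrX ler_nat
      ltnW //.
  rewrite energyD // -mulrA ler_peMr ?energy_ge0 //.
  have := energy_lower L_ge4 d_cos m (k%:R / L%:R ^+ a).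
  by rewrite -[leLHS]div1r ler_pdivrMr ?(exprn_gt0 2 lm).
move=> tot; set w := \sum_(_ <= k < _) energy d (a + m + b) _ in high *.
have hw : L%:R ^+ m / 4 <= 2 * L%:R ^+ m ^+ 2 * w by lra.
rewrite -div1r ler_pdivrMr; last by lra.
move: (L%:R ^+ m) lm hw => l l0 hw.
rewrite -(ler_pM2l l0); nra.
Qed.

Lemma sum_windows (f : nat -> R) (g : nat -> nat) (t : nat) :
  (forall i, (g i <= g i.+1)%N) ->
  \sum_(0 <= i < t) \sum_(g i <= k < g i.+1) f k = \sum_(g 0 <= k < g t) f k.
Proof.
move=> gS; elim: t => [|t IH]; first by rewrite !big_geq.
rewrite big_nat_recr //= IH -big_cat_nat //.
by elim: t {IH} => // t IH; apply: leq_trans (gS t).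
Qed.

(** Otherwise the total energy is at most [576 K], while each of the [t] disjoint windows from
    [L ^ (m i)] to [L ^ (m (i + 1))] holds at least [1 / (8 L ^ m)]. *)
Lemma nb_bad_gt K m t : (1 < K)%N ->
  (4608 * K <= L ^ m)%N -> (4608 * K * L ^ m < t)%N ->
  (L ^ (m * t) < 6 * L * K * nb_bad d K (m * t))%N.
Proof.
move=> K1 Km Kt; rewrite ltnNge; apply/negP => hb.
have L0 : (0 < L)%N by apply: leq_trans L_ge4.
have hT := total_multiplicity_le L_ge4 dB_le K1 hb (leqnn _).
have hE := sum_energy_le L_ge4 dB_le hT.
have lm := base_exp_gt0 R L_ge4 m.
have : \sum_(0 <= i < t) (8 * L%:R ^+ m)^-1 <= 576 * K%:R :> R.
  apply: (le_trans _ hE).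
  apply: (@le_trans _ _ (\sum_(0 <= i < t) \sum_(L ^ (m * i) <= k < L ^ (m *
    i.+1))
      energy d (m * t) k%:R)).
    apply: ler_sum_nat => i /andP[_ it].
    have E : (m * t = m * i + m + m * (t - i.+1))%N by rewrite -mulnSr -mulnDr
      subnKC.
    rewrite mulnSr E; apply: (window_energy_ge Km).
    by rewrite -E; exact: hE.
  rewrite (@sum_windows _ (fun i => (L ^ (m * i))%N)) => [|i].
    by apply: sum_subrange_le => // k; exact: energy_ge0.
  by rewrite leq_pexp2l // leq_mul2l leqnSn orbT.
rewrite sumr_const_nat subn0 -[_ *+ t]mulr_natl ler_pdivrMr; last lra.
rewrite (_ : 576 * _ * _ = 4608 * K%:R * L%:R ^+ m); last by ring.
by rewrite -natrX -!natrM ler_nat leqNgt Kt.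
Qed.

End Density.

(** * Covering by balls *)

Section Covering.
Variable R : realType.

(** [lebesgue_measure] is defined through an outer measure, so monotonicity holds for arbitrary
    sets, such as the projections. *)
Lemma le_lebesgue_measure (A B : set R) : A `<=` B ->
  (lebesgue_measure (A : set (measurableTypeR R)) <=
   lebesgue_measure (B : set (measurableTypeR R)))%E.
Proof.
move=> AB; rewrite /lebesgue_measure /lebesgue_stieltjes_measure.
by rewrite /measure_extension /=; exact: le_mu_ext.
Qed.

Lemma lebesgue_measure_balls_le (I : choiceType) (s : seq I) (c r : I -> R) (A
  : set R) :
  (forall i, 0 <= r i) ->
  (forall x, A x -> exists2 i, i \in s & ball (c i) (r i) x) ->
  (lebesgue_measure (A : set (measurableTypeR R)) <=
   (\sum_(i <- s) 2 * r i)%:E)%E.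
Proof.
move=> r0 As.
have {}As : A `<=` \big[setU/set0]_(i <- s) ball (c i) (r i).
  by rewrite -bigcup_seq => x /As[i si ?]; exists i.
apply: (le_trans (le_lebesgue_measure As)); elim: s {As} => [|i s IH].
  by rewrite !big_nil measure0.
rewrite !big_cons EFinD.
apply: le_trans (measureU2 _ _ _) _ => /=; first exact: measurable_ball.
  by apply: bigsetU_measurable => j _; exact: measurable_ball.
by apply: leeD => //; rewrite lebesgue_measure_ball // mulr_natl.
Qed.

Import HBNNSimple.

(** The integral is a supremum over simple functions below the integrand, and each of these
    integrates to at most [c]. Hence [f] may be any nonnegative function, such as the measure of the
    projection in terms of the direction. *)
Lemma integral_prob_le d (T : measurableType d) (P : probability T R)
    (E : set T) (f : T -> \bar R) (c : R) :
  (forall x, 0 <= f x)%E -> (forall x, E x -> f x <= c%:E)%E -> 0 <= c ->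
  (\int[P]_(x in E) f x <= c%:E)%E.
Proof.
move=> f0 fc c0.
have g0 x : (0 <= (f \_ E) x)%E by rewrite patchE; case: ifP.
rewrite integral_mkcond ge0_integralTE //.
apply: ub_ereal_sup => _ [h hf <-].
have hT : (\int[P]_(x in setT) (h x)%:E <= c%:E)%E.
  rewrite -[leRHS]mule1 -(@probability_setT _ _ _ P) -integral_cst //.
  apply: ge0_le_integral => //.
  - by move=> x _; rewrite lee_fin.
  - exact/measurable_EFinP.
  - move=> x _ /=; apply: le_trans (hf x) _; rewrite patchE.
    by case: ifPn => [/set_mem/fc //|_]; rewrite lee_fin.
by move: hT; rewrite integral_nnsfun // patch_setT.
Qed.

End Covering.

(** * Covering the projection through heavy prefixes *)

Section HeavyCover.
Variables (R : realType) (D : finType) (d : D -> R).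
Local Notation L := #|D|.
Local Notation p := (point d).
Hypothesis L_ge4 : (4 <= L)%N.
Hypothesis d_le : forall a, `|d a| <= 3 / 4 * (L%:R - 1).

Lemma point_cat_le u v : `|p (u ++ v) - p u| <= 3 / 4 * L%:R ^- size u.
Proof.
rewrite point_cat addrAC subrr add0r normrM mulrC.
rewrite (@ger0_norm _ (L%:R ^- _)) ?invr_ge0 ?exprn_ge0 //.
by rewrite ler_wpM2r ?invr_ge0 ?exprn_ge0 // point_le.
Qed.

Lemma multiplicity_catr u v : (multiplicity d v <= multiplicity d (u ++ v))%N.
Proof.
rewrite /multiplicity size_cat big_words_cat.
rewrite [leqRHS](bigD1_seq u) ?uniq_words ?mem_words //=.
apply: leq_trans (leq_addr _ _); apply: leq_sum => w _.
rewrite /near !point_cat size_cat exprD invfM opprD addrACA subrr add0r.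
rewrite -mulrBr normrM (@gtr0_norm _ (L%:R ^- _)) ?invr_gt0 ?base_exp_gt0 //.
by rewrite ler_pM2l // invr_gt0 base_exp_gt0.
Qed.

Lemma has_heavy_prefix_catr K u v :
  has_heavy_prefix d K v -> has_heavy_prefix d K (u ++ v).
Proof.
move=> /hasP[k]; rewrite mem_iota add0n /= ltnS => kv hk.
apply/hasP; exists (size u + k)%N.
  by rewrite mem_iota add0n /= ltnS size_cat leq_add2l.
rewrite take_cat ltnNge leq_addr /= addKn.
exact: leq_trans hk (multiplicity_catr _ _).
Qed.

Definition nb_good (K n : nat) : nat :=
  \sum_(w <- words D n) ~~ has_heavy_prefix d K w.

Lemma nb_goodE K n : (nb_good K n + nb_bad d K n = L ^ n)%N.
Proof.
rewrite /nb_good /nb_bad -big_split -size_words -sum1_size /=.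
by apply: eq_bigr => w _; case: has_heavy_prefix.
Qed.

(** A heavy prefix of any block makes the whole word bad, so all [r] blocks of a good word are
    good. *)
Lemma nb_good_le K b r : (nb_good K (r * b) <= nb_good K b ^ r)%N.
Proof.
elim: r => [|r IH].
  by rewrite mul0n expn0 -(expn0 L) -(nb_goodE K 0) leq_addr.
rewrite mulSn expnS; apply: leq_trans (leq_mul (leqnn _) IH).
rewrite {1}/nb_good big_words_cat big_distrl /=; apply: leq_sum => u _.
rewrite big_distrr /=; apply: leq_sum => v _.
case: (boolP (has_heavy_prefix d K u)) => [/has_heavy_prefix_cat -> //|_].
case: (boolP (has_heavy_prefix d K v)) => [/has_heavy_prefix_catr -> //|_].
exact: leq_b1.
Qed.

(** The at least [K] words near [u] have [L ^ (n - size u)] extensions each, whose points lie in the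
    ball of [u]. By disjointness each of the [L ^ n] words is counted at most once. *)
Lemma disjoint_heavy_sum_le K n (s : seq (seq D)) : uniq s ->
  {in s, forall u, heavy d K u /\ (size u <= n)%N} ->
  trivIset [set` s] (fun u => ball (p u) (3 * L%:R ^- size u)) ->
  \sum_(u <- s) K%:R * L%:R ^- size u <= 1 :> R.
Proof.
move=> us hs ts.
have Ln := base_exp_gt0 R L_ge4 n.
rewrite -(ler_pM2r Ln) mul1r.
pose B u := ball (p u) (3 * L%:R ^- size u).
apply: (@le_trans _ _ (\sum_(u <- s) \sum_(w <- words D n) (`[< B u (p w)
  >])%:R)).
  rewrite mulr_suml big_seq [leRHS]big_seq; apply: ler_sum => u su.
  have [hu un] := hs u su.
  have -> : K%:R * L%:R ^- size u * L%:R ^+ n = (K * L ^ (n - size u))%N%:R :>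
    R.
    rewrite natrM natrX -mulrA; congr (_ * _).
    by rewrite mulrC expfB_cond // gt_eqF ?base_gt0 //= orbF.
  rewrite -natr_sum ler_nat -{2}(subnKC un) big_words_cat.
  apply: (@leq_trans (multiplicity d u * L ^ (n - size u)));
    first by rewrite leq_mul.
  rewrite /multiplicity big_distrl /=; apply: big_words_le => u' su'.
  rewrite -size_words -sum1_size big_distrr /=; apply: leq_sum => v _.
  rewrite muln1; case: (boolP (near d u u')) => // nu; rewrite lt0b.
  apply/asboolP; rewrite /B /ball /=.
  have := point_cat_le u' v; rewrite su'; move: nu; rewrite /near.
  have : 0 < L%:R ^- size u :> R by rewrite invr_gt0 base_exp_gt0.
  move: (L%:R ^- size u) => z z0; rewrite !ler_norml => /andP[? ?] /andP[? ?].
  by rewrite ltr_norml; apply/andP; split; lra.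
rewrite exchange_big /= -natrX -size_words -sum1_size natr_sum.
apply: ler_sum => w _.
case: (boolP (has (fun u => `[< B u (p w) >]) s)) => [/hasP[u su hu]|/hasPn h].
  rewrite (bigD1_seq u) //= hu big_seq_cond big1 ?addr0 // => v /andP[sv vu].
  case: asboolP => // hv; case/eqP: vu; apply: ts => //.
  by exists (p w); split=> //; exact/asboolP.
by rewrite big_seq big1 // => u /h /negbTE ->.
Qed.

(* Words with a heavy prefix are covered by the balls around these prefixes,
   among which Vitali's lemma selects disjoint ones of total length [O(1/K)]. *)
Lemma lebesgue_measure_cover_le K n (A : set R) : (0 < K)%N ->
  (forall x, A x -> exists2 w, size w = n & `|p w - x| < 2 * L%:R ^- n) ->
  (lebesgue_measure (A : set (measurableTypeR R)) <=
    (4 * (nb_good K n)%:R / L%:R ^+ n + 18 / K%:R)%:E)%E.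
Proof.
move=> K0 hA.
pose B u := ball (p u) (3 * L%:R ^- size u).
have rho0 m : 0 < L%:R ^- m :> R by rewrite invr_gt0 base_exp_gt0.
pose s := [seq u <- flatten [seq words D k | k <- iota 0 n.+1] | heavy d K u].
have B0 u : B u !=set0.
  by exists (p u); apply: ballxx; rewrite mulr_gt0.
have [V [uV Vs tV cV]] := @vitali_lemma_finite_cover _ _ B
  (fun u => is_ball_ball _ _) B0 s.
have hV : {in V, forall u, heavy d K u /\ (size u <= n)%N}.
  move=> u /Vs; rewrite mem_filter => /andP[-> /flattenP[_ /mapP[k + ->]]].
  by rewrite mem_iota add0n /= ltnS mem_words => kn /eqP ->.
have sumV := disjoint_heavy_sum_le uV hV tV.
pose G := [seq w <- words D n | ~~ has_heavy_prefix d K w].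
(* Good words keep their own balls; the balls selected by Vitali's lemma are enlarged three times,
   so the radius factor 3 becomes 9 and the length 18. *)
pose c (i : seq D + seq D) := match i with inl w => p w | inr u => p u end.
pose r (i : seq D + seq D) : R := match i with
  inl w => 2 * L%:R ^- n | inr u => 9 * L%:R ^- size u end.
have cover x : A x -> exists2 i, i \in map inl G ++ map inr V & ball (c i) (r
  i) x.
  move=> /hA[w wn wx].
  have [/hasP[k]|good] := boolP (has_heavy_prefix d K w); last first.
    exists (inl w) => //.
    by rewrite mem_cat map_f // mem_filter good mem_words wn eqxx.
  rewrite mem_iota add0n /= ltnS wn => kn hk.
  have sk : size (take k w) = k by rewrite size_takel ?wn.
  have ks : take k w \in s.
    rewrite mem_filter hk; apply/flattenP; exists (words D k).
      by apply/mapP; exists k; rewrite ?mem_iota ?add0n ?ltnS.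
    by rewrite mem_words sk.
  (* This fixes the radius factor 3: [2 + 3 / 4 < 3]. *)
  have Bx : B (take k w) x.
    have := point_cat_le (take k w) (drop k w); rewrite cat_take_drop sk.
    rewrite /B /ball /= sk.
    have : L%:R ^- n <= L%:R ^- k :> R.
      rewrite lef_pV2 ?posrE ?base_exp_gt0 // ler_weXn2l // ler1n.
      exact: leq_trans L_ge4.
    move: wx (rho0 n) (rho0 k).
    move: (L%:R ^- n) (L%:R ^- k) => y z; rewrite !ler_norml !ltr_norml.
    by move=> /andP[? ?] ? ? ? /andP[? ?]; apply/andP; split; lra.
  have [|u Vu /=] := cV x; first by exists (take k w).
  rewrite /B scale_ballE // mulrA -natrM => ux.
  by exists (inr u) => //; rewrite mem_cat orbC map_f.
apply: le_trans (lebesgue_measure_balls_le _ cover) _.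
  by case=> u /=; rewrite mulr_ge0 // ltW.
rewrite lee_fin big_cat !big_map /=; apply: lerD.
  rewrite big_const_seq count_predT iter_addr_0 size_filter.
  rewrite /nb_good -sum1_count -[X in _ <= 4 * X%:R / _]big_mkcond /=.
  by rewrite -mulr_natr; lra.
rewrite ler_pdivlMr ?ltr0n //.
rewrite (_ : _ * _ = 18 * \sum_(u <- V) K%:R * L%:R ^- size u) ?ler_piMr //.
by rewrite mulr_suml mulr_sumr; apply: eq_bigr => u _; ring.
Qed.

End HeavyCover.

(** * The digit set *)

Section DigitWords.
Variable R : realType.

Definition digit (i : 'I_5) : R := nth 0 [:: 0; 1; 2; 6; 9] i.

Lemma digit_bounds i : 0 <= digit i <= 9.
Proof.
by case: i => -[|[|[|[|[|//]]]]] ? /=; rewrite /digit /= ?lexx ?ler01 ?ler0n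
  ?ler_nat ?ler1n.
Qed.

(** For a product digit set the exponential sum factors, so the one-dimensional lower bound serves
    every direction. *)
Lemma cos_sq_sum_pair (I J : finType) (f : I -> R) (g : J -> R) (x : R) :
  cos_sq_sum (enum {: I * J}) (fun k => f k.1 + g k.2) x =
  cos_sq_sum (enum I) f x * cos_sq_sum (enum J) g x.
Proof.
rewrite /cos_sq_sum !big_enum /=.
set c := \sum_(i : I) cos _; set s := \sum_(i : I) sin _.
set c' := \sum_(i : J) cos _; set s' := \sum_(i : J) sin _.
have -> : \sum_(k : I * J) cos ((f k.1 + g k.2) * x) = c * c' - s * s'.
  rewrite -(pair_bigA _ (fun i j => cos ((f i + g j) * x))) /=.
  rewrite /c /s !big_distrl /= -sumrB; apply: eq_bigr => i _.
  rewrite !big_distrr /= -sumrB; apply: eq_bigr => j _.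
  by rewrite mulrDl cosD.
have -> : \sum_(k : I * J) sin ((f k.1 + g k.2) * x) = s * c' + c * s'.
  rewrite -(pair_bigA _ (fun i j => sin ((f i + g j) * x))) /=.
  rewrite /c /s !big_distrl /= -big_split; apply: eq_bigr => i _.
  rewrite /= !big_distrr /= -big_split; apply: eq_bigr => j _.
  by rewrite mulrDl sinD.
by ring.
Qed.

Lemma cos_sq_sum_digit (t x : R) : 1 <= cos_sq_sum (enum 'I_5) (fun i =>
  digit i * t) x.
Proof.
have ds : [:: 0; 1; 2; 6; 9] = [seq digit i | i <- enum 'I_5] :> seq R.
  by rewrite /digit (map_comp (nth 0 _) val) val_enum_ord.
have := digits_cos_sq_sum_ge1 (t * x).
rewrite ds /cos_sq_sum !big_map => h; apply: (le_trans h).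
by under eq_bigr do rewrite mulrA; under [X in _ + X ^+ 2]eq_bigr do rewrite
  mulrA.
Qed.

Definition proj_digit (theta : R * R) (a : 'I_5 * 'I_5) : R :=
  digit a.1 * theta.1 + digit a.2 * theta.2.

Lemma card_digits : #|{: 'I_5 * 'I_5}| = 25%N.
Proof. by rewrite card_prod !card_ord. Qed.

Lemma unit_circle_le (theta : R * R) : unit_circle theta ->
  theta.1 ^+ 2 + theta.2 ^+ 2 = 1 /\ (`|theta.1| <= 1 /\ `|theta.2| <= 1).
Proof.
rewrite /unit_circle /enorm /= => h.
have e : theta.1 ^+ 2 + theta.2 ^+ 2 = 1.
  rewrite -[RHS](expr1n _ 2) -h sqr_sqrtr /dotp -?expr2 //.
  by rewrite addr_ge0 ?sqr_ge0.
split=> //; move: (sqr_ge0 theta.1) (sqr_ge0 theta.2) => h1 h2.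
by split; rewrite -[leLHS]sqrtr_sqr -[leRHS]sqrtr1 ler_wsqrtr //; lra.
Qed.

Section Direction.
Variable theta : R * R.
Hypothesis theta1 : unit_circle theta.
Local Notation d := (proj_digit theta).

Lemma digits_ge4 : (4 <= #|{: 'I_5 * 'I_5}|)%N.
Proof. by rewrite card_digits. Qed.

(** Digits are at most 9 and the coordinates of [theta] at most 1 in absolute value; [9 + 9] is
    exactly [3 / 4 * 24]. *)
Lemma proj_digit_le a : `|d a| <= 3 / 4 * (#|{: 'I_5 * 'I_5}|%:R - 1).
Proof.
rewrite card_digits; have [_ []] := unit_circle_le theta1.
rewrite /proj_digit !ler_norml => /andP[? ?] /andP[? ?].
have /andP[? ?] := digit_bounds a.1; have /andP[? ?] := digit_bounds a.2.
by apply/andP; split; nra.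
Qed.

Lemma proj_digitB_le a b : `|d a - d b| <= 3 / 4 * (#|{: 'I_5 * 'I_5}|%:R - 1).
Proof.
rewrite card_digits; have [_ [h1 h2]] := unit_circle_le theta1.
have -> : d a - d b = (digit a.1 - digit b.1) * theta.1 +
    (digit a.2 - digit b.2) * theta.2 by rewrite /proj_digit; ring.
apply: le_trans (ler_normD _ _) _; rewrite !normrM.
have k i j : `|digit i - digit j| <= 9.
  have := digit_bounds i; have := digit_bounds j => /andP[? ?] /andP[? ?].
  by rewrite ler_norml; apply/andP; split; lra.
have := ler_pM (normr_ge0 _) (normr_ge0 _) (k a.1 b.1) h1.
have := ler_pM (normr_ge0 _) (normr_ge0 _) (k a.2 b.2) h2.
lra.
Qed.

Lemma proj_digit_cos x : 1 <= cos_sq_sum (enum {: 'I_5 * 'I_5}) d x.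
Proof.
rewrite (cos_sq_sum_pair (fun i => digit i * theta.1) (fun j =>
  digit j * theta.2)).
by rewrite -[1]mulr1 ler_pM // cos_sq_sum_digit.
Qed.

Lemma proj_le_enorm z : `|Defs.proj theta z| <= enorm z.
Proof.
have [e _] := unit_circle_le theta1.
rewrite -sqrtr_sqr /enorm ler_wsqrtr // /Defs.proj /dotp.
(* Cauchy-Schwarz by Lagrange's identity. *)
have := sqr_ge0 (z.1 * theta.2 - z.2 * theta.1).
have : (z.1 * z.1 + z.2 * z.2) * (theta.1 ^+ 2 + theta.2 ^+ 2) =
  z.1 * z.1 + z.2 * z.2 by rewrite e mulr1.
lra.
Qed.

Lemma projB (x y : R * R) : Defs.proj theta (x - y) = Defs.proj theta x -
  Defs.proj theta y.
Proof. by rewrite /Defs.proj /dotp /=; ring. Qed.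

Lemma point_mkseq (omega : nat -> 'I_5 * 'I_5) (alpha : nat -> R * R) n :
  (forall k, alpha k.+1 = (digit (omega k).1, digit (omega k).2)) ->
  point d (mkseq omega n) =
  Defs.proj theta (\sum_(1 <= k < n.+1) 25%:R ^- k *: alpha k).
Proof.
move=> ha; elim: n => [|n IH].
  by rewrite big_geq // /Defs.proj /dotp /= !mul0r addr0.
rewrite mkseqS -cats1 point_cat size_mkseq card_digits IH /= [in
  RHS]big_nat_recr //=.
rewrite ha /Defs.proj /dotp /proj_digit card_digits /= exprS invfM addr0.
by rewrite /GRing.scale /=; ring.
Qed.

(** In units of [25 ^ -n] the errors are 1 from the neighbourhood, 1/10 from a deep truncation of
    the expansion and 3/4 from keeping [n] digits. *)
Lemma proj_nbhd_cover N n x : (n <= N)%N ->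
  (Defs.proj theta @` nbhd (25%:R ^- N) (product_cantor 25 digits digits)) x ->
  exists2 w, size w = n & `|point d w - x| < 2 * #|{: 'I_5 * 'I_5}|%:R ^- n.
Proof.
move=> nN [z + <-]; rewrite /nbhd /edist_set /= => /ereal_inf_lt[_ [y Sy <-]].
rewrite lte_fin => zy; case: Sy => alpha [hA ya].
have dig (a : R) : digits a -> exists i : 'I_5, a = digit i.
  rewrite /digits /= => /(nthP 0)[i i5 <-].
  by exists (Ordinal i5).
have /choice[omega ho] : forall k, exists o : 'I_5 * 'I_5,
    alpha k.+1 = (digit o.1, digit o.2).
  move=> k.
  have [/dig[i hi] /dig[j hj]] := hA k.+1 isT.
  by exists (i, j); rewrite /= -hi -hj; case: (alpha k.+1).
exists (mkseq omega n); first by rewrite size_mkseq.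
rewrite card_digits.
set rho := 25%:R ^- n.
have rho0 : 0 < rho by rewrite invr_gt0 exprn_gt0.
have zy' : `|Defs.proj theta z - Defs.proj theta y| < rho.
  rewrite -projB; apply: le_lt_trans (proj_le_enorm _) _.
  apply: lt_le_trans zy _; rewrite lef_pV2 ?posrE ?exprn_gt0 //.
  by rewrite ler_weXn2l // ler1n.
have [m nm ym] : exists2 m, (n <= m)%N &
    `|Defs.proj theta y - point d (mkseq omega m)| <= rho / 10.
  (* Convergence is in the sup norm, and each of the two coordinates contributes [rho / 20]. *)
  have e0 : 0 < rho / 20 by rewrite divr_gt0.
  move/cvgrPdist_le: ya => /(_ _ e0)[k _ hk].
  exists (maxn k n); first exact: leq_maxr.
  have := hk (maxn k n).+1 (leq_trans (leq_maxl _ _) (leqnSn _)).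
  rewrite (point_mkseq _ ho) -projB /=; set v := y - _.
  rewrite prod_normE ge_max => /andP[v1 v2].
  have [_ [t1 t2]] := unit_circle_le theta1.
  rewrite /Defs.proj /dotp; apply: le_trans (ler_normD _ _) _; rewrite !normrM.
  have := ler_pM (normr_ge0 _) (normr_ge0 _) v1 t1.
  have := ler_pM (normr_ge0 _) (normr_ge0 _) v2 t2.
  lra.
have := point_cat_le digits_ge4 proj_digit_le (mkseq omega n) (drop n (mkseq
  omega m)).
have -> : mkseq omega n = take n (mkseq omega m).
  by rewrite /mkseq -map_take take_iota (minn_idPl nm).
rewrite cat_take_drop size_takel ?size_mkseq // card_digits -/rho.
move: zy' ym; rewrite ler_norml !ltr_norml !ler_norml.
by move=> /andP[? ?] /andP[? ?] /andP[? ?]; apply/andP; split; lra.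
Qed.

End Direction.
End DigitWords.

(** * Choice of parameters *)

Section Rate.
Variable R : realType.

(* [K = 25 ^ q]: blocks of length [(q + 3) * 25 ^ (2 * q + 6)] each contain a
   heavy prefix with probability at least [1 / (150 * K)], and
   [150 * K * 5 * q] of them are used. *)
Definition depth (q : nat) : nat :=
  (750 * q * 25 ^ q * ((q + 3) * 25 ^ (2 * q + 6)))%N.

Lemma expR_N5_le (q : nat) : expR (- (5 * q%:R)) <= 25%:R ^- q :> R.
Proof.
rewrite expRN lef_pV2 ?posrE ?expR_gt0 ?exprn_gt0 // mulrC expRM_natl.
apply: lerXn2r; rewrite ?nnegrE ?expR_ge0 //.
rewrite -[5]mulr1 expRM_natl.
apply: (@le_trans _ _ (2 ^+ 5)); first by rewrite -natrX ler_nat.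
by apply: lerXn2r; rewrite ?nnegrE ?expR_ge0 //; have := expR_ge1Dx (1 : R);
  lra.
Qed.

Lemma lebesgue_measure_proj_le (theta : R * R) q N : (0 < q)%N ->
  unit_circle theta -> (depth q <= N)%N ->
  (lebesgue_measure (Defs.proj theta @`
     nbhd (25%:R ^- N) (product_cantor 25 digits digits) :
       set (measurableTypeR R)) <= (22 / 25%:R ^+ q)%:E)%E.
Proof.
move=> q0 theta1 hN.
pose K := (25 ^ q)%N; pose m := (q + 3)%N; pose t := (25 ^ (2 * q + 6))%N.
pose b := (m * t)%N; pose r := (750 * q * 25 ^ q)%N.
have K0 : (0 < K)%N by rewrite expn_gt0.
(* Accounts for [m = q + 3] and, once more, for the exponent [2 * q + 6 = q + m + 3] of [t]. The 150
   below is [6 * 25]. *)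
have l3 : (4608 < 25 ^ 3)%N by [].
have hb : (25 ^ b < 150 * K * nb_bad (proj_digit theta) K b)%N.
  have := @nb_bad_gt _ _ _ digits_ge4 (@proj_digitB_le _ theta theta1)
    (@proj_digit_cos _ theta) K m t.
  rewrite card_digits; apply.
  - by rewrite /K -{1}(expn0 25) ltn_exp2l.
  - by rewrite /K /m expnD [leqRHS]mulnC leq_mul2r (ltnW l3) orbT.
  - have -> : t = (K * 25 ^ m * 25 ^ 3)%N.
      by rewrite /t /K /m -!expnD; congr (_ ^ _)%N; lia.
    by rewrite -mulnA mulnC ltn_pmul2l // muln_gt0 K0 expn_gt0.
have good : (nb_good (proj_digit theta) K (r * b))%:R / 25%:R ^+ (r * b) <=
    25%:R ^- q :> R.
  have l0 n : 0 < 25%:R ^+ n :> R by rewrite exprn_gt0.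
  have gE := nb_goodE (proj_digit theta) K b; rewrite card_digits in gE.
  have gr := nb_good_le (proj_digit theta) digits_ge4 K b r.
  set x := (nb_good (proj_digit theta) K b)%:R / 25%:R ^+ b : R.
  have K0R : 0 < K%:R :> R by rewrite ltr0n.
  have x0 : 0 <= x by rewrite divr_ge0 // ltW.
  have x1 : x <= 1 - (150 * K%:R)^-1.
    have gER := congr1 (fun n : nat => n%:R : R) gE; rewrite natrD natrX in gER.
    have : (150 * K%:R)^-1 * 25%:R ^+ b <=
        (nb_bad (proj_digit theta) K b)%:R :> R.
      by rewrite ler_pdivrMl ?mulr_gt0 // -natrX -!natrM ler_nat ltnW.
    by rewrite /x ler_pdivrMr // mulrBl mul1r; lra.
  apply: (@le_trans _ _ (x ^+ r)).
    rewrite /x expr_div_n -exprM mulnC ler_pM2r ?invr_gt0 //.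
    by rewrite -natrX ler_nat mulnC.
  apply: le_trans (expR_N5_le q).
  (* [1 - s <= exp (- s)] with [s = 1 / (150 K)]; the choice of [r] makes [s * r = 5 q]. *)
  apply: (@le_trans _ _ (expR (- (150 * K%:R)^-1) ^+ r)).
    apply: lerXn2r; rewrite ?nnegrE ?expR_ge0 //.
    by apply: le_trans x1 (expR_ge1Dx _).
  have rE : r%:R = 750 * q%:R * K%:R :> R by rewrite -!natrM.
  rewrite -expRM_natl ler_expR rE.
  have fE (k z : R) : k != 0 -> 750 * z * k * - (150 * k)^-1 = - (5 * z).
    by move=> k0; field.
  by rewrite fE // gt_eqF.
have := @lebesgue_measure_cover_le _ _ _ digits_ge4 (@proj_digit_le _ theta
  theta1) K (r * b)
  (Defs.proj theta @` nbhd (25%:R ^- N) (product_cantor 25 digits digits)) K0.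
rewrite card_digits => h; apply: le_trans (h _) _.
  move=> x /(proj_nbhd_cover theta1 hN)[w sw].
  by rewrite card_digits => wx; exists w.
rewrite lee_fin /K natrX -[4 * _ / _]mulrA.
have : 0 < (25%:R ^+ q)^-1 :> R by rewrite invr_gt0 exprn_gt0.
by move: good; lra.
Qed.

Lemma depth_succ_le : exists2 M : R, 0 <= M &
  forall q, (depth q.+1)%:R <= M * (q%:R + 4) ^+ 2 * (25%:R ^+ q) ^+ 3.
Proof.
exists (750 * 25 ^ 9)%N%:R => [|q]; first exact: ler0n.
rewrite -natrD -!natrX -!natrM ler_nat.
rewrite /depth (_ : 2 * q.+1 + 6 = q + q + 8)%N; last by lia.
rewrite [(25 ^ (q + q + 8))%N]expnD [(25 ^ (q + q))%N]expnD.
rewrite [(25 ^ q.+1)%N]expnS [(25 ^ 9)%N]expnS.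
move: (25 ^ q)%N (25 ^ 8)%N => y z.
apply: (@leq_trans (750 * (25 * z) * ((q + 1) * (q + 4)) * y ^ 3)).
  by rewrite eq_leq //; ring.
by rewrite -mulnn !leq_mul // leq_add2l.
Qed.

(** With [e = 1 / 3 - u > 0], [N ^ e] is at most a constant times
    [(q + 4) ^ (2 e) * 25 ^ (q (1 - 3 u))]. The saved factor [25 ^ (- 3 u q) = exp (- c q) <= 1 / (1
    + c q)] absorbs the polynomial, as [2 e <= 1]. *)
Lemma depth_rate (u : R) : 0 < u -> exists2 C, 0 < C &
  forall q N, (0 < q)%N -> (depth q <= N)%N -> (N < depth q.+1)%N ->
    22 / 25%:R ^+ q <= C * N%:R `^ (- (1 / 3) + u).
Proof.
move=> u0; have [M M0 hM] := depth_succ_le.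
pose e := 1 / 3 - u; pose c := 3 * u * ln (25%:R : R).
have c0 : 0 < c by rewrite !mulr_gt0 // ln_gt0 // ltr1n.
pose C0 := M `^ e.
pose C1 := 4 + c^-1.
have C0_ge0 : 0 <= C0 by exact: powR_ge0.
have C1_ge0 : 0 <= C1 by rewrite addr_ge0 ?invr_ge0 // ltW.
exists (22 * (1 + C0 * C1)) => [|q N q0 qN Nq].
  by rewrite mulr_gt0 // ltr_pwDl // mulr_ge0.
have N1 : 1 <= N%:R :> R.
  rewrite ler1n; apply: leq_trans qN.
  by rewrite /depth !muln_gt0 q0 addn_gt0 !expn_gt0 orbT.
have X0 : 0 < 25%:R ^+ q :> R by rewrite exprn_gt0.
rewrite -mulrA ler_pM2l //.
have -> : - (1 / 3) + u = - e by rewrite /e; ring.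
(* For [u >= 1 / 3] the power of [N] is at least 1; the summand 1 in the constant covers this
   case. *)
have [e0|e0] := leP e 0.
  apply: (@le_trans _ _ 1); first by rewrite invf_le1 // exprn_ege1 // ler1n.
  have : 1 <= N%:R `^ (- e) by rewrite -[leLHS](powRr0 N%:R); apply: ler_powR;
    rewrite ?oppr_ge0.
  by have := mulr_ge0 C0_ge0 C1_ge0; nra.
have Ne0 : 0 < N%:R `^ e :> R by rewrite powR_gt0 // (lt_le_trans _ N1).
rewrite powRN ler_pdivlMr // mulrC ler_pdivrMr //.
have NB : N%:R <= M * (q%:R + 4) ^+ 2 * (25%:R ^+ q) ^+ 3.
  by apply: le_trans (hM q); rewrite ler_nat ltnW.
have e1 : 2 * e <= 1 by rewrite /e; lra.
have q40 : 1 <= q%:R + 4 :> R by rewrite (le_trans (_ : 1 <= 4)) ?ler1n //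
  lerDr.
have hq4 : ((q%:R + 4 : R) ^+ 2) `^ e <= q%:R + 4.
  rewrite -powR_mulrn ?(le_trans ler01) // -powRrM.
  by rewrite -[leRHS]powRr1 ?(le_trans ler01) // ler_powR.
have hX : (((25%:R : R) ^+ q) ^+ 3) `^ e * (1 + c * q%:R) <= 25%:R ^+ q.
  rewrite -(powR_mulrn 3 (ltW X0)) -powRrM.
  rewrite (_ : 3%:R * e = 1 - 3 * u); last by rewrite /e; lra.
  rewrite powRB; last by rewrite (lt0r_neq0 X0) implybT.
  rewrite (powRr1 (ltW X0)) -[leRHS]mulr1 -mulrA ler_pM2l //.
  rewrite mulrC ler_pdivrMr ?powR_gt0 // mul1r.
  rewrite /powR gt_eqF // lnXn //.
  apply: le_trans (expR_ge1Dx _); rewrite lerD2l /c -mulr_natr.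
  by lra.
have hq : q%:R + 4 <= C1 * (1 + c * q%:R).
  have q0' : 0 <= q%:R :> R by [].
  have ci0 : 0 < c^-1 by rewrite invr_gt0.
  have cq := mulr_ge0 (ltW c0) q0'.
  rewrite /C1 mulrDl [c^-1 * _]mulrDr [c^-1 * (c * _)]mulKf ?gt_eqF //.
  by move: (c * q%:R) (c^-1) cq ci0 => x y; lra.
have NE : N%:R `^ e <= C0 * (q%:R + 4) * ((25%:R ^+ q) ^+ 3) `^ e.
  have Y0 : 0 <= (q%:R + 4 : R) ^+ 2 by exact: sqr_ge0.
  have Z0 : 0 <= (25%:R ^+ q) ^+ 3 :> R by rewrite exprn_ge0 // ltW.
  have MY0 := mulr_ge0 M0 Y0.
  apply: (le_trans (ge0_ler_powR (ltW e0) _ _ NB)).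
  - by rewrite nnegrE (le_trans ler01).
  - by rewrite nnegrE mulr_ge0.
  rewrite (powRM _ MY0 Z0) (powRM _ M0 Y0).
  by apply: ler_wpM2r; [exact: powR_ge0|exact: ler_wpM2l].
apply: (le_trans NE).
have P0 := powR_ge0 ((25%:R ^+ q) ^+ 3 : R) e.
move: ((_ ^+ 3) `^ e) P0 hX => P P0 hX.
apply: (@le_trans _ _ (C0 * (C1 * (P * (1 + c * q%:R))))).
  have := ler_wpM2l (mulr_ge0 C0_ge0 P0) hq; lra.
apply: (@le_trans _ _ (C0 * (C1 * 25%:R ^+ q))).
  by rewrite !ler_wpM2l.
rewrite mulrA mulrDl mul1r; lra.
Qed.

End Rate.

Theorem theorem2p5 (R : realType) (u : R) (hu : 0 < u) :
  exists (Nu : nat) (Cu : R), 0 < Cu /\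
    forall N : nat, (Nu <= N)%N ->
      (favard (nbhd (25%:R ^- N) (product_cantor 25 digits digits))
        <= (Cu * N%:R `^ (- (1 / 3) + u))%:E)%E.
Proof.
have [C C0 hC] := depth_rate hu.
exists (depth 1), C; split=> // N N1.
have depth_ge q : (q <= depth q)%N.
  rewrite /depth -!mulnA mulnCA leq_pmulr // !muln_gt0 !expn_gt0.
  by rewrite addn_gt0 orbT.
have ex : exists q, (0 < q)%N && (depth q <= N)%N by exists 1%N.
have ub q : (0 < q)%N && (depth q <= N)%N -> (q <= N)%N.
  by move=> /andP[_]; apply: leq_trans.
(* The largest [q] with [depth q <= N], so that [N] lies between consecutive depths; [N >= depth 1]
   makes it positive. *)
have [q /andP[q0 qN] qmax] := ex_maxnP ex ub.
have Nq : (N < depth q.+1)%N.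
  by rewrite ltnNge; apply/negP => h; have := qmax q.+1 h; rewrite ltnn.
apply: (@le_trans _ _ (22 / 25%:R ^+ q)%:E); last by rewrite lee_fin hC.
apply: integral_prob_le => // theta theta1.
exact: lebesgue_measure_proj_le.
Qed.
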